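(* Let $\mathcal{A}$ be a von Neumann algebra and $S$ some collection of weakly continuous linear symmetry maps on $\mathcal{A}$. Let $\varphi$ be a weakly continuous linear symmetry map on $\mathcal{A}$ with order $2$ that commutes with each symmetry of $S$. Let $X,B\in\mathcal{A}$ with $X$ self-adjoint, $S$-symmetric and with $\|X\|,\|B\|\le1$. Suppose further that $\varphi(X)=-X$ and $\varphi(B)=\eta B$ (resp. $\varphi_*(B)=\eta B$) for a phase $\eta\in\mathbb{C}$. If there are commuting $X',B'\in\mathcal{A}$ with $X'$ self-adjoint and $S$-symmetric and with $$\varepsilon=\max(\|X'-X\|,\|B'-B\|),$$ then there are commuting $X'',B''\in\mathcal{A}$ with $X''$ self-adjoint and $S$-symmetric, $$\|X''-X\|,\ \|B''-B\|\le45\sqrt{\varepsilon},$$ $\varphi(X'')=-X''$, and $\varphi(B'')=\eta B''$ (resp. $\varphi_*(B'')=\eta B''$). The operator $X''$ constructed only depends on $X,X',\varphi,\varepsilon$. The map defining $B\mapsto B''$ is (the value at $B$ of) a completely positive linear map of norm $1$ on $\mathcal{A}$ that commutes with each symmetry in $S$.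
   Context: ''Linear'' means $\mathbb{C}$-linear. A linear symmetry map on a unital $C^*$-algebra $\mathcal{A}$ is a linear map $\varphi:\mathcal{A}\to\mathcal{A}$ that is hermitian ($\varphi(A^* )=\varphi(A)^*$), maps non-invertible elements to non-invertible elements, satisfies $\varphi(I)=I$, and is multiplicative or anti-multiplicative ($\varphi(AB)=\varphi(B)\varphi(A)$). $\varphi$ has order $2$ if $\varphi^2=\mathrm{id}\ne\varphi$. $\varphi_*(A):=\varphi(A^* )$. ''Weakly continuous'' refers to the weak operator topology. $A$ is $S$-symmetric if $\psi(A)=A$ for all $\psi\in S$. A phase is a complex number of modulus $1$. *)

(* Defs.v *)
From HB Require Import structures.
From mathcomp Require Import all_boot all_order all_algebra.
From mathcomp Require Export complex.
From mathcomp Require Import all_classical all_reals all_analysis.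

Set Implicit Arguments.
Unset Strict Implicit.
Unset Printing Implicit Defensive.

Import Order.TTheory GRing.Theory Num.Theory Num.Def.
Import numFieldNormedType.Exports.

Local Open Scope classical_set_scope.
Local Open Scope ring_scope.

Section Hilbert.
Variables (R : realType) (H : completeNormedModType R[i]).
Variable dot : {dot H for (conjC : R[i] -> R[i])}.

(* [H] is a Banach space; together with this condition it is a complex Hilbert
   space (the inner product is linear in its first argument) *)
Definition hilbert := forall x : H, dot x x = `|x| ^+ 2.

(* Operators on [H] are plain functions carrying the pointwise vector space
   structure; the product of operators is composition. *)
Definition bounded_operator (T : H -> H) :=
  linear T /\ exists M : R[i], forall x, `|T x| <= M * `|x|.

(* [`|x|] is a nonnegative real element of [R[i]] *)
Definition opnorm (T : H -> H) : R :=
  sup [set complex.Re `|T x| | x in [set x : H | `|x| <= 1]].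

(* [T'] is the adjoint of [T]; it is unique, and exists (Riesz) as soon as [T]
   is bounded, so that [adj T] is then the Hilbert space adjoint *)
Definition adjoint_of (T T' : H -> H) :=
  forall x y, dot (T x) y = dot x (T' y).

Definition adj (T : H -> H) : H -> H := xget 0 (adjoint_of T).

Definition selfadjoint (T : H -> H) := adj T = T.

Definition wot : topologicalType :=
  initial_topology
    ((fun T (xy : H * H) => dot (T xy.1) xy.2) :
       (H -> H) -> {ptws H * H -> R[i]^o}).

(* The algebra is closed in the weak operator topology of the space of bounded
   operators; pointwise weak limits of nets may be unbounded, whence the
   intersection in [vna_closed]. *)
Record von_neumann_algebra (A : set (H -> H)) : Prop := {
  vna_bounded : A `<=` bounded_operator;
  vna_id : A idfun;
  vna_linear : forall (c : R[i]) (a b : H -> H),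
    A a -> A b -> A (c *: a + b);
  vna_comp : forall a b : H -> H, A a -> A b -> A (a \o b);
  vna_adj : forall a : H -> H, A a -> exists2 a', A a' & adjoint_of a a';
  vna_closed : closure (A : set wot) `&` bounded_operator `<=` A }.

Section MapsOnAlgebra.
Variable A : set (H -> H).

(* A map on [A] is represented by a function on all of [H -> H] whose values
   outside [A] are irrelevant. *)
Local Notation opmap := ((H -> H) -> (H -> H)).

Definition linear_map_on (f : opmap) :=
  (forall a, A a -> A (f a)) /\
  (forall (c : R[i]) (a b : H -> H),
     A a -> A b -> f (c *: a + b) = c *: f a + f b).

Definition invertible_in (a : H -> H) :=
  exists2 b, A b & a \o b = idfun /\ b \o a = idfun.

Record linear_symmetry (f : opmap) : Prop := {
  lsym_linear : linear_map_on f;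
  lsym_hermitian : forall a, A a -> f (adj a) = adj (f a);
  lsym_noninvertible : forall a, A a ->
    ~ invertible_in a -> ~ invertible_in (f a);
  lsym_id : f idfun = idfun;
  lsym_mul : (forall a b, A a -> A b -> f (a \o b) = f a \o f b) \/
             (forall a b, A a -> A b -> f (a \o b) = f b \o f a) }.

Definition weakly_continuous (f : opmap) :=
  {within (A : set wot), continuous (f : wot -> wot)}.

Definition order_two (f : opmap) :=
  (forall a, A a -> f (f a) = a) /\ (exists2 a, A a & f a <> a).

Definition commute_on (f g : opmap) := forall a, A a -> f (g a) = g (f a).

Definition lower_star (f : opmap) : opmap := fun a => f (adj a).

Definition S_symmetric (S : set opmap) (a : H -> H) :=
  forall f, S f -> f a = a.

(* positivity of an operator matrix as an operator on [H ^ n] *)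
Definition positive_mx n (a : 'I_n -> 'I_n -> H -> H) :=
  forall v : 'I_n -> H, 0 <= \sum_i \sum_j dot (a i j (v j)) (v i).

Definition completely_positive (f : opmap) :=
  forall n (a : 'I_n -> 'I_n -> H -> H), (forall i j, A (a i j)) ->
    positive_mx a -> positive_mx (fun i j => f (a i j)).

Definition mapnorm (f : opmap) : R :=
  sup [set opnorm (f a) | a in [set a | A a /\ opnorm a <= 1]].

End MapsOnAlgebra.
End Hilbert.

(* Main.v *)
Require Import Defs.
From HB Require Import structures.
From mathcomp Require Import all_boot all_order all_algebra.
From mathcomp Require Import all_classical all_reals all_analysis.
From mathcomp Require Import ring lra.

Import Order.TTheory GRing.Theory Num.Theory Num.Def.
Import numFieldNormedType.Exports.

Set Implicit Arguments.
Unset Strict Implicit.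
Unset Printing Implicit Defensive.

Local Open Scope classical_set_scope.
Local Open Scope ring_scope.

(** Put [r = sqrt eps].  If [r > 1/45] the required bounds are so weak that
[X'' = 0] and [B'' = B] satisfy them, and [eps = 0] forces [X' = X] and
[B' = B].  The content is the range [0 < r <= 1/45].

The spectral projections of [X'] commute with [B'], so that pinching [B] by
them moves it by at most [2 eps].  They are however not permuted by [phi],
because [Y = - phi X'] is only within [2 eps] of [X'].  The remedy is to keep
only the spectrum of [X'] above [r], and to let [phi] create the negative part.
Let [E] be the spectral projection of [X'] above [r], cut into finitely many
[E_i] on which [X'] varies by at most [r]; put [F = phi E] and
[F_i = phi E_i].  Then [F] is a spectral projection of [Y] below [- r].  Two
spectral sets at distance [2 r] of two operators at distance [2 eps] give
[|E F| <= eps / r = r] ([separated_norm_le]).  The square root is the best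
compromise between this bound and the error [r] made by discarding the part of
the spectrum near [0].

The nearly orthogonal pair [E], [F] is then made orthogonal without breaking
the symmetry between them ([lowdin_orthogonalization]).  If [Q] is the
projection on the kernel of [E + F], then [S = E + F + Q] is within [2 r] of
[1], and with [T] the inverse square root of [S] the operators [T E_i T],
[T F_i T] and [Q = T Q T] are mutually orthogonal projections with sum [1].
As [phi] fixes [E + F] it fixes [T], hence it exchanges [T E_i T] and
[T F_i T].  Now [X''] is the sum of the [(i + 1) r (T E_i T - T F_i T)], and
[B''] is the pinching of [B] by the whole family ([structured_pinching]).
Every multiplicative or antimultiplicative map sends [p b p] to
[s p * s b * s p], which is why one pinching is compatible with [phi] and with
all of the symmetries in [S].  The displacement of [B] is small because the
[E_i] commute with [B'] and the [F_i] with [eta^-1 theta B'], both of which are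
within [eps] of [B].

The spectral theory is obtained from strong limits of polynomials in a single
operator: square roots from a monotone iteration, kernel projections from
powers, spectral projections from the kernel of [|T| + T].  Such limits are
self-adjoint, commute with everything in the algebra that commutes with the
operator, and are fixed by every weakly continuous symmetry that fixes it.
The predicate [generated] records these three properties. *)

(** * The real inner product *)

Section RealHilbert.
Variables (R : realType) (H : completeNormedModType R[i]).
Variable dot : {dot H for (conjC : R[i] -> R[i])}.
Hypothesis hdot : hilbert dot.

(** The real part of the inner product is a real inner product with the same
norm.  Adjoints and positivity of complex linear operators can be tested on it,
and its values live in an ordered field. *)
Definition redot (x y : H) : R := complex.Re (dot x y).
Definition renorm (x : H) : R := complex.Re `|x|.

Local Notation ip := redot.
Local Notation N := renorm.

Lemma renormE x : `|x| = (N x)%:C%C.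
Proof. by rewrite /renorm complex.RRe_real ?normr_real. Qed.

Lemma renorm_ge0 x : 0 <= N x.
Proof. by rewrite -(lecR 0 (N x)) -renormE; exact: normr_ge0. Qed.

Lemma renormD x y : N (x + y) <= N x + N y.
Proof. by rewrite -lecR rmorphD /= -!renormE ler_normD. Qed.

Lemma renormN x : N (- x) = N x. Proof. by rewrite /renorm normrN. Qed.

Lemma renorm0 : N 0 = 0. Proof. by rewrite /renorm normr0. Qed.

Lemma renorm_eq0 x : N x = 0 -> x = 0.
Proof. by move=> h; apply/eqP; rewrite -normr_eq0 renormE h. Qed.

Lemma renorm_distC x y : N (x - y) = N (y - x). Proof. by rewrite -renormN opprB. Qed.

Lemma renormB x y : N (x - y) <= N x + N y.
Proof. by rewrite -(renormN y) renormD. Qed.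

Lemma renormZ (r : R) x : N (r%:C%C *: x) = `|r| * N x.
Proof.
apply: complexI; rewrite rmorphM /= -!renormE normrZ; congr (_ * _).
by rewrite normc_def /= expr0n addr0 sqrtr_sqr.
Qed.

Lemma redotDl x y z : ip (x + y) z = ip x z + ip y z.
Proof. by rewrite /redot linearDl raddfD. Qed.
Lemma redotC x y : ip x y = ip y x.
Proof.
rewrite /redot (hermC (dot : {hermitian _ for _ & _})) /= expr0 mul1r.
by case: (dot y x).
Qed.
Lemma redotDr x y z : ip x (y + z) = ip x y + ip x z.
Proof. by rewrite !(redotC x) redotDl. Qed.
Lemma redotZl (r : R) x y : ip (r%:C%C *: x) y = r * ip x y.
Proof. by rewrite /redot linearZl_LR /=; case: (dot x y) => a b /=; rewrite mul0r subr0. Qed.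
Lemma redotZr (r : R) x y : ip x (r%:C%C *: y) = r * ip x y.
Proof. by rewrite redotC redotZl redotC. Qed.
Lemma redotNl x y : ip (- x) y = - ip x y.
Proof. by rewrite /redot linearNl raddfN. Qed.
Lemma redotNr x y : ip x (- y) = - ip x y.
Proof. by rewrite redotC redotNl redotC. Qed.
Lemma redotBl x y z : ip (x - y) z = ip x z - ip y z.
Proof. by rewrite redotDl redotNl. Qed.
Lemma redotBr x y z : ip x (y - z) = ip x y - ip x z.
Proof. by rewrite redotDr redotNr. Qed.
Lemma redot0l y : ip 0 y = 0. Proof. by rewrite -(subrr 0) redotBl subrr. Qed.
Lemma redot0r y : ip y 0 = 0. Proof. by rewrite redotC redot0l. Qed.

Lemma redotxx x : ip x x = N x ^+ 2.
Proof. by rewrite /redot hdot renormE -rmorphXn. Qed.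

Lemma redot_ge0 x : 0 <= ip x x. Proof. by rewrite redotxx sqr_ge0. Qed.

Lemma redot_ext x y : (forall z, ip x z = ip y z) -> x = y.
Proof.
move=> h; apply/eqP; rewrite -subr_eq0; apply/eqP/renorm_eq0/eqP.
by rewrite -sqrf_eq0 -redotxx redotBl h subrr.
Qed.

Lemma redot_CS x y : ip x y <= N x * N y.
Proof.
have [/renorm_eq0 ->|y0] := eqVneq (N y) 0; first by rewrite redot0r renorm0 mulr0.
have [/renorm_eq0 ->|x0] := eqVneq (N x) 0; first by rewrite redot0l renorm0 mul0r.
have := redot_ge0 ((N y)%:C%C *: x - (N x)%:C%C *: y).
rewrite !(redotBl, redotBr, redotZl, redotZr) (redotC y) !redotxx => h.
have xy : 0 < N x * N y by rewrite lt0r mulf_neq0 // mulr_ge0 // renorm_ge0.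
rewrite -(ler_pM2l xy); nra.
Qed.

Lemma redot_abs x y : `|ip x y| <= N x * N y.
Proof.
by rewrite ler_norml redot_CS andbT lerNl -redotNl (le_trans (redot_CS _ _)) // renormN.
Qed.

(** The imaginary part is a real inner product as well, so weak convergence can
be controlled by real inner products only. *)
Lemma dotE x y : dot x y = (ip x y +i* ip x ('i%C *: y))%C.
Proof.
rewrite /redot linearZr_LR /=; case: (dot x y) => a b.
by congr (_ +i* _)%C; rewrite /= mul0r sub0r mulN1r opprK.
Qed.

Lemma dot_ext x y : (forall z, dot z x = dot z y) -> x = y.
Proof. by move=> h; apply: redot_ext => z; rewrite !(redotC _ z) /redot h. Qed.

Definition scvg (u : nat -> H) (l : H) := (fun n => N (u n - l)) @ \oo --> (0:R).

Lemma scvg_complete (u : nat -> H) :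
  (forall e : R, 0 < e -> exists n0, forall m n, (n0 <= m)%N -> (n0 <= n)%N ->
     N (u m - u n) <= e) -> exists l, scvg u l.
Proof.
move=> hu.
have : cauchy (u @ \oo).
  apply/cauchy_ballP => e e0.
  have [e1 e1E]: exists e1 : R, e = (e1%:C)%C.
    by exists (complex.Re e); rewrite complex.RRe_real // ger0_real // ltW.
  move: e0; rewrite e1E (ltcR 0) => e0.
  have e2 : 0 < e1 / 2 by rewrite divr_gt0.
  have [n0 hn0] := hu _ e2.
  exists ([set u n | n in [set n | (n0 <= n)%N]], [set u n | n in [set n | (n0 <= n)%N]]).
    by split; exists n0 => //= n hn; exists n.
  move=> [/= x y] [[m hm <-] [n hn <-]].
  rewrite -ball_normE /ball_ /= renormE ltcR (le_lt_trans (hn0 _ _ hm hn)) //.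
  lra.
move=> /cauchy_cvgP /cvg_ex [l hl]; exists l.
apply/cvgrPdist_le => e e0.
move/cvgrPdist_lt : hl => /(_ (e%:C)%C); rewrite (ltcR 0) => /(_ e0).
apply: filterS => n; rewrite renormE ltcR sub0r normrN renorm_distC => /ltW.
by rewrite ger0_norm // renorm_ge0.
Qed.

Lemma scvg_ip u l y : scvg u l -> (fun n => ip (u n) y) @ \oo --> ip l y.
Proof.
move=> h; apply/subr_cvg0; apply/norm_cvg0P.
apply: (@squeeze_cvgr _ _ _ _ (cst 0) (fun n => N (u n - l) * N y)).
- by near=> n; rewrite normr_ge0 /= -redotBl redot_abs.
- exact: cvg_cst.
- by rewrite -(mul0r (N y)); apply: cvgMl.
Unshelve. all: by end_near. Qed.

Lemma scvg_uniq u l l' : scvg u l -> scvg u l' -> l = l'.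
Proof.
move=> h h'; apply: redot_ext => z.
have a := scvg_ip (y := z) h; have b := scvg_ip (y := z) h'; by apply: (cvg_unique (@Rhausdorff R) a b).
Qed.

Lemma scvgN_cst u l c : scvg u l -> (fun n => N (u n - c)) @ \oo --> N (l - c).
Proof.
move=> h; apply/subr_cvg0; apply/norm_cvg0P.
apply: (@squeeze_cvgr _ _ _ _ (cst 0) (fun n => N (u n - l))) => //.
- near=> n; rewrite normr_ge0 /= ler_distl.
  have h1 := renormD (u n - l) (l - c).
  have h2 := renormD (l - u n) (u n - c).
  rewrite addrA subrK in h1; rewrite addrA subrK (renorm_distC l (u n)) in h2.
  apply/andP; split; lra.
- exact: cvg_cst.
Unshelve. all: by end_near. Qed.

Lemma scvgD u v l m : scvg u l -> scvg v m -> scvg (fun n => u n + v n) (l + m).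
Proof.
move=> h h'; rewrite /scvg.
apply: (@squeeze_cvgr _ _ _ _ (cst 0) (fun n => N (u n - l) + N (v n - m))).
- by near=> n; rewrite renorm_ge0 /= opprD addrACA renormD.
- exact: cvg_cst.
- by rewrite -(addr0 0); apply: cvgD.
Unshelve. all: by end_near. Qed.

Lemma scvgZ c u l : scvg u l -> scvg (fun n => c *: u n) (c *: l).
Proof.
move=> h; rewrite /scvg.
rewrite [X in X @ _](_ : _ = fun n => complex.Re `|c| * N (u n - l)).
  by rewrite -(mulr0 (complex.Re `|c|)); apply: cvgMr.
apply: funext => n; rewrite -scalerBr /renorm normrZ renormE.
by rewrite -[`|c|]complex.RRe_real ?normr_real // -rmorphM.
Qed.

Lemma scvg_cst l : scvg (fun=> l) l.
Proof. by rewrite /scvg subrr renorm0; apply: cvg_cst. Qed.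

Lemma scvg_squeeze u l (f : nat -> R) :
  (forall n, N (u n - l) <= f n) -> f @ \oo --> 0 -> scvg u l.
Proof.
move=> h hf; apply: (@squeeze_cvgr _ _ _ _ (cst 0) f) => //.
- by near=> n; rewrite renorm_ge0 /=.
- exact: cvg_cst.
Unshelve. all: by end_near. Qed.

Lemma scvg_S u l : scvg u l -> scvg (fun n => u n.+1) l.
Proof. by rewrite /scvg => h; rewrite (cvg_shiftS (fun n => N (u n - l))). Qed.

End RealHilbert.

(** * The algebra as a ring *)

Section AlgebraStructure.
Variables (R : realType) (H : completeNormedModType R[i]).
Variable dot : {dot H for (conjC : R[i] -> R[i])}.
Variable A : set (H -> H).
Hypothesis hdot : hilbert dot.
Variable hA : von_neumann_algebra dot A.

(** The proof that [A] is a von Neumann algebra is an argument of the type, so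
that the ring operations can be attached to it canonically. *)
Definition vN of von_neumann_algebra dot A : Type := {a : H -> H | a \in A}.

HB.instance Definition _ := SubType.copy (vN hA) {a : H -> H | a \in A}.
HB.instance Definition _ := Choice.copy (vN hA) {a : H -> H | a \in A}.

Definition app (a : vN hA) : H -> H := val a.
Coercion app : vN >-> Funclass.

Lemma vN_in (a : vN hA) : A a.
Proof. by have := valP a; rewrite inE. Qed.

Definition mkvN (f : H -> H) (fA : A f) : vN hA := Sub f (mem_set fA).

Lemma mkvNE f (fA : A f) : mkvN fA = f :> (H -> H).
Proof. by rewrite /mkvN /app SubK. Qed.

Lemma vN_ext (a b : vN hA) : (forall x, a x = b x) -> a = b.
Proof. by move=> h; apply/val_inj/funext. Qed.

Lemma A_lin (c : R[i]) (a b : H -> H) : A a -> A b -> A (c *: a + b).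
Proof. exact: (vna_linear hA). Qed.

Lemma A_comp (a b : H -> H) : A a -> A b -> A (a \o b).
Proof. exact: (vna_comp hA). Qed.

Lemma A0 : A 0.
Proof.
have := A_lin (-1) (vna_id hA) (vna_id hA).
by rewrite scaleN1r addNr.
Qed.

Lemma A_scale c a : A a -> A (c *: a).
Proof. by move=> h; rewrite -(addr0 (c *: a)); apply: A_lin => //; apply: A0. Qed.

Lemma A_add a b : A a -> A b -> A (a + b).
Proof. by move=> h h'; rewrite -(scale1r a); apply: A_lin. Qed.

Lemma A_opp a : A a -> A (- a).
Proof. by rewrite -scaleN1r; apply: A_scale. Qed.

Definition vadd (a b : vN hA) : vN hA := mkvN (A_add (vN_in a) (vN_in b)).
Definition vopp (a : vN hA) : vN hA := mkvN (A_opp (vN_in a)).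
Definition vzero : vN hA := mkvN A0.
Definition vmul (a b : vN hA) : vN hA := mkvN (A_comp (vN_in a) (vN_in b)).
Definition vone : vN hA := mkvN (vna_id hA).
Definition vscale (r : R) (a : vN hA) : vN hA := mkvN (A_scale (r%:C)%C (vN_in a)).

Lemma app_lin (a : vN hA) : linear a.
Proof. by have [] := vna_bounded hA (vN_in a). Qed.

HB.instance Definition _ (a : vN hA) :=
  GRing.isLinear.Build R[i] H H *:%R (app a) (app_lin a).

Fact vaddA : associative vadd.
Proof. by move=> a b c; apply: vN_ext => x; rewrite !mkvNE /= !fctE addrA. Qed.
Fact vaddC : commutative vadd.
Proof. by move=> a b; apply: vN_ext => x; rewrite !mkvNE /= !fctE addrC. Qed.
Fact vadd0 : left_id vzero vadd.
Proof. by move=> a; apply: vN_ext => x; rewrite !mkvNE /= !fctE add0r. Qed.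
Fact vaddN : left_inverse vzero vopp vadd.
Proof. by move=> a; apply: vN_ext => x; rewrite !mkvNE /= !fctE addNr. Qed.

HB.instance Definition _ := GRing.isZmodule.Build (vN hA) vaddA vaddC vadd0 vaddN.

Fact vmulA : associative vmul.
Proof. by move=> a b c; apply: vN_ext => x; rewrite !mkvNE. Qed.
Fact vmul1 : left_id vone vmul.
Proof. by move=> a; apply: vN_ext => x; rewrite !mkvNE. Qed.
Fact vmulr1 : right_id vone vmul.
Proof. by move=> a; apply: vN_ext => x; rewrite !mkvNE. Qed.
Fact vmulDl : left_distributive vmul vadd.
Proof. by move=> a b c; apply: vN_ext => x; rewrite !mkvNE. Qed.
Fact vmulDr : right_distributive vmul vadd.
Proof. by move=> a b c; apply: vN_ext => x; rewrite !mkvNE /= !fctE linearD. Qed.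

HB.instance Definition _ := GRing.Zmodule_isPzRing.Build (vN hA)
  vmulA vmul1 vmulr1 vmulDl vmulDr.

Fact vscaleA r s a : vscale r (vscale s a) = vscale (r * s) a.
Proof. by apply: vN_ext => x; rewrite !mkvNE /= rmorphM -scalerA. Qed.
Fact vscale1 : left_id 1 vscale.
Proof. by move=> a; apply: vN_ext => x; rewrite !mkvNE /= scale1r. Qed.
Fact vscaleDr : right_distributive vscale +%R.
Proof. by move=> r a b; apply: vN_ext => x; rewrite !mkvNE /= scalerDr. Qed.
Fact vscaleDl a : {morph vscale^~ a : r s / r + s}.
Proof. by move=> r s; apply: vN_ext => x; rewrite !mkvNE /= rmorphD scalerDl. Qed.

(** Only real scalars act: they preserve self-adjointness, and the functional
calculus below is real. *)
HB.instance Definition _ := GRing.Zmodule_isLmodule.Build R (vN hA)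
  vscaleA vscale1 vscaleDr vscaleDl.

Fact vscaleAl (r : R) (a b : vN hA) : r *: (a * b) = r *: a * b.
Proof. by apply: vN_ext => x. Qed.
Fact vscaleAr (r : R) (a b : vN hA) : r *: (a * b) = a * (r *: b).
Proof. by apply: vN_ext => x; rewrite /= !mkvNE /= !fctE linearZ. Qed.

Lemma appD (a b : vN hA) x : app (a + b) x = a x + b x. Proof. by []. Qed.
Lemma appN (a : vN hA) x : app (- a) x = - a x. Proof. by []. Qed.
Lemma appB (a b : vN hA) x : app (a - b) x = a x - b x. Proof. by []. Qed.
Lemma appM (a b : vN hA) x : app (a * b) x = a (b x). Proof. by []. Qed.
Lemma app1 x : app (1 : vN hA) x = x. Proof. by []. Qed.
Lemma app0 x : app (0 : vN hA) x = 0. Proof. by []. Qed.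
Lemma appZ (r : R) (a : vN hA) x : app (r *: a) x = (r%:C)%C *: a x. Proof. by []. Qed.
Lemma app_sum I (r : seq I) (P : pred I) (F : I -> vN hA) x :
  app (\sum_(i <- r | P i) F i) x = \sum_(i <- r | P i) F i x.
Proof. by elim/big_rec2: _ => // i y z _ <-. Qed.

Lemma appDr (a : vN hA) x y : a (x + y) = a x + a y. Proof. exact: linearD. Qed.
Lemma appBr (a : vN hA) x y : a (x - y) = a x - a y. Proof. exact: linearB. Qed.
Lemma app0r (a : vN hA) : a 0 = 0. Proof. exact: linear0. Qed.
Lemma appZr (a : vN hA) (c : R[i]) x : a (c *: x) = c *: a x. Proof. exact: linearZ. Qed.

Lemma adj_ex (a : vN hA) : adjoint_of dot a (adj dot a) /\ A (adj dot a).
Proof.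
have [a' a'A ha'] := vna_adj hA (vN_in a).
rewrite /adj; case: xgetP => [f E hf|/(_ a')]; last by [].
suff -> : f = a' by [].
apply: funext => x; apply: (dot_ext hdot) => z.
by rewrite -ha' -hf.
Qed.

Definition star (a : vN hA) : vN hA := mkvN (adj_ex a).2.

Local Notation st := star.

Lemma starE (a : vN hA) : st a = adj dot a :> (H -> H). Proof. by []. Qed.

Local Notation ip := (redot dot).
Local Notation N := (@renorm R H).

Lemma redot_star (a : vN hA) x y : ip (a x) y = ip x (st a y).
Proof. by rewrite /redot (adj_ex a).1. Qed.

Definition selfadj (a : vN hA) := forall x y, ip (a x) y = ip x (a y).

Lemma selfadjP a : selfadj a <-> st a = a.
Proof.
split=> [h|h x y]; last by rewrite redot_star h.
by apply: vN_ext => x; apply: (redot_ext hdot) => z; rewrite redotC -redot_star h redotC.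
Qed.

Lemma star_uniq (a b : vN hA) : (forall x y, ip (a x) y = ip x (b y)) -> st a = b.
Proof.
move=> h; apply: vN_ext => x; apply: (redot_ext hdot) => z.
by rewrite redotC -redot_star h redotC.
Qed.

Lemma starK a : st (st a) = a.
Proof. by apply: star_uniq => x y; rewrite redotC -redot_star redotC. Qed.

Lemma starM a b : st (a * b) = st b * st a.
Proof. by apply: star_uniq => x y; rewrite !appM !redot_star. Qed.

Lemma selfadjointE (a : vN hA) : selfadjoint dot a <-> selfadj a.
Proof.
rewrite selfadjP /selfadjoint -starE; split=> [h|-> //].
by apply: vN_ext => x; rewrite h.
Qed.

Lemma selfadj1 : selfadj 1. Proof. by []. Qed.
Lemma selfadj0 : selfadj 0. Proof. by move=> x y; rewrite !app0 redot0l redot0r. Qed.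
Lemma selfadjD a b : selfadj a -> selfadj b -> selfadj (a + b).
Proof. by move=> h h' x y; rewrite !appD redotDl redotDr h h'. Qed.
Lemma selfadjN a : selfadj a -> selfadj (- a).
Proof. by move=> h x y; rewrite !appN redotNl redotNr h. Qed.
Lemma selfadjB a b : selfadj a -> selfadj b -> selfadj (a - b).
Proof. by move=> h h'; apply: selfadjD => //; apply: selfadjN. Qed.
Lemma selfadjZ r a : selfadj a -> selfadj (r *: a).
Proof. by move=> h x y; rewrite !appZ redotZl redotZr h. Qed.
Lemma selfadjM a b : selfadj a -> selfadj b -> a * b = b * a -> selfadj (a * b).
Proof. by move=> h h' ab x y; rewrite {1}ab !appM h' h. Qed.
Lemma selfadj_conj a b : selfadj a -> selfadj b -> selfadj (a * b * a).
Proof. by move=> h h' x y; rewrite !appM h h' h. Qed.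
Lemma selfadj_sum I (r : seq I) (P : pred I) (F : I -> vN hA) :
  (forall i, P i -> selfadj (F i)) -> selfadj (\sum_(i <- r | P i) F i).
Proof. by move=> h; elim/big_ind: _ => //; [exact: selfadj0|exact: selfadjD]. Qed.

(** Equivalent to [opnorm a <= c] for nonnegative [c] ([opnorm_le] and
[norm_le_opnorm]), without the supremum. *)
Definition norm_le (c : R) (a : vN hA) := forall x, N (a x) <= c * N x.

Lemma norm_le_ex a : exists2 c, 0 < c & norm_le c a.
Proof.
have [_ [M hM]] := vna_bounded hA (vN_in a).
exists (`|complex.Re M| + 1) => [|x]; first by rewrite ltr_wpDl.
have := hM x; rewrite !renormE.
case: M {hM} => m1 m2 /=; rewrite lecE /= => /andP[_].
rewrite mulr0 subr0 => h; apply: (le_trans h).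
by apply: ler_wpM2r; rewrite ?renorm_ge0 // ler_wpDr // ler_norm.
Qed.

Lemma opnorm_le (a : vN hA) c : 0 <= c -> norm_le c a -> opnorm a <= c.
Proof.
move=> c0 h; apply: sup_le_ub.
  by exists (complex.Re `|app a 0|); exists 0 => //=; rewrite normr0.
move=> _ [x /= hx <-]; apply: (le_trans (h x)); rewrite ler_piMr //.
by move: hx; rewrite renormE -[1]/((1:R)%:C%C) lecR.
Qed.

Lemma opnorm_has_sup (a : vN hA) :
  has_sup [set complex.Re `|app a x| | x in [set x : H | `|x| <= 1]].
Proof.
have [M M0 hM] := norm_le_ex a; split.
  by exists (complex.Re `|app a 0|); exists 0 => //=; rewrite normr0.
exists M => _ [y /= hy <-]; apply: (le_trans (hM y)); rewrite ler_piMr ?(ltW M0) //.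
by move: hy; rewrite renormE -[1]/((1:R)%:C%C) lecR.
Qed.

Lemma opnorm_ge0 (a : vN hA) : 0 <= opnorm a.
Proof.
apply: (sup_upper_bound (opnorm_has_sup a)).
by exists 0 => /=; rewrite ?app0r normr0.
Qed.

Lemma norm_le_opnorm (a : vN hA) c : opnorm a <= c -> norm_le c a.
Proof.
move=> h x; have [/(@renorm_eq0 _ _) ->|x0] := eqVneq (N x) 0.
  by rewrite app0r renorm0 mulr0.
have xp : 0 < N x by rewrite lt0r x0 renorm_ge0.
rewrite -ler_pdivrMr // mulrC -[X in X * _]gtr0_norm ?invr_gt0 //.
rewrite -renormZ -appZr; apply: le_trans h; apply: (sup_upper_bound (opnorm_has_sup a)).
eexists; last reflexivity.
rewrite /= renormE -[1]/((1:R)%:C%C) lecR renormZ gtr0_norm ?invr_gt0 //.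
by rewrite mulVf.
Qed.

Lemma norm_leW c d a : c <= d -> norm_le c a -> norm_le d a.
Proof. by move=> cd h x; apply: (le_trans (h x)); rewrite ler_wpM2r ?renorm_ge0. Qed.
Lemma norm_leD c d a b : norm_le c a -> norm_le d b -> norm_le (c + d) (a + b).
Proof.
by move=> h h' x; rewrite appD mulrDl (le_trans (renormD _ _)) // lerD.
Qed.
Lemma norm_leN c a : norm_le c a -> norm_le c (- a).
Proof. by move=> h x; rewrite appN renormN. Qed.
Lemma norm_leB c d a b : norm_le c a -> norm_le d b -> norm_le (c + d) (a - b).
Proof. by move=> h h'; apply: norm_leD => //; apply: norm_leN. Qed.
Lemma norm_leM c d a b : 0 <= c -> norm_le c a -> norm_le d b -> norm_le (c * d) (a * b).
Proof.
by move=> c0 h h' x; rewrite appM (le_trans (h _)) // -mulrA ler_wpM2l.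
Qed.
Lemma norm_le1 : norm_le 1 1. Proof. by move=> x; rewrite mul1r. Qed.
Lemma norm_le_distC c a b : norm_le c (a - b) -> norm_le c (b - a).
Proof. by move=> h; rewrite -opprB; apply: norm_leN. Qed.

Lemma norm_leP c a : 0 <= c -> norm_le c a <-> (forall x, ip (a x) (a x) <= c ^+ 2 * ip x x).
Proof.
move=> c0; split=> h x.
  by rewrite !redotxx // -exprMn lerXn2r ?nnegrE ?mulr_ge0 ?renorm_ge0.
by rewrite -(@ler_pXn2r _ 2) ?nnegrE ?mulr_ge0 ?renorm_ge0 // exprMn -!(redotxx hdot).
Qed.

End AlgebraStructure.

(** * Strong limits and symmetries *)

Lemma normc_dist (R : realType) (a b c d : R) :
  `|(a +i* b)%C - (c +i* d)%C| <= (`|a - c| + `|b - d|)%:C%C.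
Proof.
have -> : (a +i* b)%C - (c +i* d)%C = (a - c)%:C%C + 'i%C * (b - d)%:C%C.
  by simpc.
apply: (le_trans (ler_normD _ _)).
rewrite normrM.
have -> : `|'i%C : R[i]| = 1 by rewrite normc_def /= expr0n add0r expr1n sqrtr1.
by rewrite mul1r !normc_def /= !expr0n !addr0 !sqrtr_sqr -rmorphD lecR.
Qed.

Section Symmetries.
Variables (R : realType) (H : completeNormedModType R[i]).
Variable dot : {dot H for (conjC : R[i] -> R[i])}.
Variable A : set (H -> H).
Hypothesis hdot : hilbert dot.
Variable hA : von_neumann_algebra dot A.

Local Notation ip := (redot dot).
Local Notation N := (@renorm R H).
Local Notation V := (vN hA).
Local Notation st := (star hdot).

Definition strong_lim (u : nat -> V) (a : V) := forall x, scvg (fun n => u n x) (a x).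

Lemma strong_lim_uniq u a b : strong_lim u a -> strong_lim u b -> a = b.
Proof. by move=> h h'; apply: vN_ext => x; apply: (scvg_uniq hdot (h x)). Qed.

Lemma wot_cvg (u : nat -> H -> H) (f : H -> H) :
  (forall x, scvg (fun n => u n x) (f x)) ->
  (u : nat -> wot dot) @ \oo --> (f : wot dot).
Proof.
move=> h.
pose E (T : H -> H) : {ptws H * H -> R[i]^o} := fun xy => dot (T xy.1) xy.2.
have hE : {ptws, (fun n => E (u n)) @ \oo --> E f}.
  apply/pointwise_cvgP => -[x y]; rewrite /E /=.
  suff : (fun n => dot (u n x) y : R[i]^o) @ \oo --> (dot (f x) y : R[i]^o) by exact.
  apply/cvgrPdist_le => e e0.
  have [e1 e1E]: exists e1 : R, e = (e1%:C)%C.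
    by exists (complex.Re e); rewrite complex.RRe_real // ger0_real // ltW.
  move: e0; rewrite e1E (ltcR 0) => e0.
  have e2 : 0 < e1 / 2 by lra.
  have h1 := scvg_ip hdot (y := y) (h x).
  have h2 := scvg_ip hdot (y := 'i%C *: y) (h x).
  move/cvgrPdist_le : h1 => /(_ _ e2) h1.
  move/cvgrPdist_le : h2 => /(_ _ e2) h2.
  near=> n.
  rewrite !dotE (le_trans (normc_dist _ _ _ _)) // lecR.
  have -> : e1 = e1 / 2 + e1 / 2 by lra.
  by apply: lerD; near: n.
move=> U [W [[B Bop BW] Wf] WU].
have nB : nbhs (E f) B by apply: open_nbhs_nbhs; split=> //; rewrite -BW in Wf.
have /= := hE _ nB.
rewrite !nbhs_simpl /=; apply: filterS => n Bn; apply: WU.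
by rewrite -BW.
Unshelve. all: by end_near. Qed.

(** A uniformly bounded sequence that converges pointwise has a bounded linear
limit; it is also the weak limit of members of the algebra, hence a member. *)
Lemma strong_lim_ex (u : nat -> V) c : 0 <= c -> (forall n, norm_le c (u n)) ->
  (forall x, exists l, scvg (fun n => u n x) l) -> exists2 a : V, norm_le c a & strong_lim u a.
Proof.
move=> c0 hc /choice [f hf].
have fl : linear f.
  move=> k x y; apply: (scvg_uniq hdot (hf _)).
  have := scvgD (scvgZ k (hf x)) (hf y).
  by congr (scvg _ _); apply: funext => n; rewrite linearP.
have fb x : N (f x) <= c * N x.
  have := scvgN_cst (c := 0) (hf x); rewrite subr0 => h.
  apply: (@cvgr_to_le _ _ _ _ _ _ _ h).
  by near=> n; rewrite subr0; apply: hc.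
have fA : A f.
  apply: (vna_closed hA); split; last first.
    split=> //; exists c%:C%C => x; rewrite !renormE -rmorphM lecR; exact: fb.
  move=> B nB; have := wot_cvg hf nB.
  rewrite nbhs_simpl /= => -[n0 _ /(_ n0 (leqnn _)) /= hn].
  by exists (u n0); split=> //; apply: vN_in.
by exists (mkvN hA fA).
Unshelve. all: by end_near. Qed.

(** The last field is the form in which weak continuity is used: the set of
fixed points is closed under strong limits of sequences. *)
Record vn_symmetry (s : V -> V) : Prop := {
  symD : forall a b, s (a + b) = s a + s b;
  symZ : forall r a, s (r *: a) = r *: s a;
  sym1 : s 1 = 1;
  sym_star : forall a, s (st a) = st (s a);
  symM : (forall a b, s (a * b) = s a * s b) \/ (forall a b, s (a * b) = s b * s a);
  sym_lim : forall u a, strong_lim u a -> (forall n, s (u n) = u n) -> s a = a }.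

Local Notation symmetry := vn_symmetry.

Definition on_algebra f (hf : linear_symmetry dot A f) (a : V) : V :=
  mkvN hA ((lsym_linear hf).1 _ (vN_in a)).

Lemma on_algebraE f (hf : linear_symmetry dot A f) a : on_algebra hf a = f a :> (H -> H).
Proof. by []. Qed.

(** For the limit property: if [f] fixes all [u n], then [u n] converges weakly
to [a] and, by continuity, also to [f a]. *)
Lemma on_algebra_symmetry f (hf : linear_symmetry dot A f) :
  weakly_continuous dot A f -> symmetry (on_algebra hf).
Proof.
move=> wc.
have lP := (lsym_linear hf).2.
have fE (a b : V) : (app a = app b) -> a = b by move=> h; apply: val_inj.
split.
- move=> a b; apply: fE; rewrite on_algebraE.
  rewrite (_ : app (a + b) = 1 *: app a + app b); last by rewrite scale1r.
  rewrite lP; [|exact: vN_in|exact: vN_in].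
  by rewrite scale1r.
- move=> r a; apply: fE; rewrite on_algebraE.
  rewrite (_ : app (r *: a) = (r%:C)%C *: app a + app (0 : V)); last first.
    by rewrite [X in _ + X](_ : _ = 0) ?addr0.
  rewrite lP; [|exact: vN_in|exact: vN_in].
  rewrite (_ : f (app (0 : V)) = 0) ?addr0 //.
  have := lP (-1) (app (0 : V)) (app (0 : V)) (vN_in _) (vN_in _).
  rewrite !scaleN1r addNr.
  by rewrite addNr.
- by apply: fE; rewrite on_algebraE; exact: (lsym_id hf).
- move=> a; apply: fE; rewrite on_algebraE !starE.
  by rewrite (lsym_hermitian hf) //; exact: vN_in.
- have [h|h] := lsym_mul hf; [left|right] => a b; apply: fE; rewrite on_algebraE.
    by rewrite (h _ _ (vN_in a) (vN_in b)).
  by rewrite (h _ _ (vN_in a) (vN_in b)).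
- move=> u a ua fu; apply/esym; apply: vN_ext => x; apply: (redot_ext hdot) => z.
  rewrite on_algebraE.
  move/(@subspace_continuousP (wot dot)): wc => /(_ (app a) (vN_in a)) wc.
  have ua' : (fun n => app (u n) : wot dot) @ \oo --> within A (nbhs (app a : wot dot)).
    move=> U; rewrite /within /= => nU.
    have := wot_cvg ua nU; rewrite !nbhs_simpl /=; apply: filterS => n; apply.
    exact: vN_in.
  have h2 := cvg_comp _ _ ua' wc.
  have h3 : (fun n => app (u n) : wot dot) @ \oo --> (f (app a) : wot dot).
    rewrite (_ : (fun n => app (u n)) = f \o (fun n => app (u n))) //.
    by apply: funext => n /=; have := congr1 (fun w : V => app w) (fu n).
  have h4 : (fun n => dot (u n x) z : R[i]^o) @ \oo --> (dot (f (app a) x) z : R[i]^o).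
    have /pointwise_cvgP/(_ (x, z)) := cvg_comp _ _ h3 (@initial_continuous _ _
     ((fun T (xy : H * H) => dot (T xy.1) xy.2) :
       (H -> H) -> {ptws H * H -> R[i]^o}) (f (app a))).
    exact.
  have h5 : (fun n => ip (u n x) z) @ \oo --> ip (f (app a) x) z.
    apply/cvgrPdist_le => e e0; move/cvgrPdist_le : h4 => /(_ (e%:C)%C).
    rewrite (ltcR 0 e) => /(_ e0); apply: filterS => n.
    move=> hn; rewrite -lecR /redot -raddfB.
    have hn' : `|dot (f (app a) x) z - dot (u n x) z : R[i]| <= (e%:C)%C := hn.
    exact: (le_trans (normc_ge_Re (dot (f (app a) x) z - dot (u n x) z)) hn').
  exact: (cvg_unique (@Rhausdorff R) (scvg_ip hdot (ua x)) h5).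
Qed.
End Symmetries.

(** * Square roots, kernels and spectral projections *)

Section Spectral.
Variables (R : realType) (H : completeNormedModType R[i]).
Variable dot : {dot H for (conjC : R[i] -> R[i])}.
Variable A : set (H -> H).
Hypothesis hdot : hilbert dot.
Variable hA : von_neumann_algebra dot A.

Local Notation ip := (redot dot).
Local Notation N := (@renorm R H).
Local Notation V := (vN hA).
Local Notation st := (star hdot).
Local Notation symmetry := (vn_symmetry hdot).

Implicit Types a b c T : V.

Lemma redot_norm_le c (r : R) x : norm_le r c -> ip (c x) x <= r * ip x x.
Proof.
move=> h; apply: (le_trans (redot_CS hdot _ _)).
by rewrite redotxx // expr2 mulrA ler_wpM2r ?renorm_ge0.
Qed.

Lemma redot_norm_geN c (r : R) x : norm_le r c -> - (r * ip x x) <= ip (c x) x.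
Proof. by move=> /norm_leN/(@redot_norm_le _ _ x); rewrite appN redotNl => h; rewrite lerNl. Qed.

Definition op_ge0 a := selfadj a /\ forall x, 0 <= ip (a x) x.

Lemma op_ge01 : op_ge0 1. Proof. by split=> // x; rewrite app1 redot_ge0. Qed.
Lemma op_ge00 : op_ge0 0. Proof. by split=> [|x]; [exact: selfadj0|rewrite app0 redot0l]. Qed.
Lemma op_ge0D a b : op_ge0 a -> op_ge0 b -> op_ge0 (a + b).
Proof.
move=> [ha pa] [hb pb]; split=> [|x]; first exact: selfadjD.
by rewrite appD redotDl addr_ge0.
Qed.
Lemma op_ge0Z r a : 0 <= r -> op_ge0 a -> op_ge0 (r *: a).
Proof.
move=> r0 [ha pa]; split=> [|x]; first exact: selfadjZ.
by rewrite appZ redotZl mulr_ge0.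
Qed.
Lemma op_ge0_conj a b : selfadj b -> op_ge0 a -> op_ge0 (b * a * b).
Proof.
move=> hb [ha pa]; split=> [|x]; first exact: selfadj_conj.
by rewrite !appM hb.
Qed.
Lemma op_ge0_sqr b : selfadj b -> op_ge0 (b * b).
Proof. by move=> hb; rewrite -[X in X * _]mulr1; apply: op_ge0_conj => //; exact: op_ge01. Qed.

(** Induction in steps of two: [a ^+ n.+2 = a * a ^+ n * a]. *)
Lemma op_ge0X a k : op_ge0 a -> op_ge0 (a ^+ k).
Proof.
move=> pa; suff [] : op_ge0 (a ^+ k) /\ op_ge0 (a ^+ k.+1) by [].
elim: k => [|k [h1 h2]]; first by rewrite expr0 expr1; split=> //; exact: op_ge01.
split=> //; rewrite exprS exprSr mulrA; apply: op_ge0_conj => //; exact: pa.1.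
Qed.

(** The norm of a self-adjoint operator is bounded by its quadratic form: with
[P = r + a] and [M = r - a], both positive, and [P + M = 2 r],
[2 r (r ^+ 2 - a ^+ 2) = P M P + M P M]. *)
Lemma norm_le_form a r : 0 < r -> selfadj a ->
  (forall x, ip (a x) x <= r * ip x x) -> (forall x, - (r * ip x x) <= ip (a x) x) ->
  norm_le r a.
Proof.
move=> r0 sA h1 h2; apply/(norm_leP hdot); first exact: ltW.
move=> x.
have := h1 ((r%:C)%C *: x + a x); have := h2 ((r%:C)%C *: x - a x).
have E : ip (a (a x)) x = ip (a x) (a x) by rewrite sA.
rewrite appBr appDr !appZr !(redotDl, redotDr, redotNl, redotNr, redotZl, redotZr) E (redotC dot x (a x)).
move: (ip (a x) (a x)) (ip x x) (ip (a x) x) (ip (a (a x)) (a x)) => p q s t l1 l2.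
rewrite -(ler_pM2l r0); nra.
Qed.

Lemma norm_le_op_ge0 a r : 0 < r -> op_ge0 a -> (forall x, ip (a x) x <= r * ip x x) -> norm_le r a.
Proof.
move=> r0 [ha pa] h; apply: norm_le_form => // x.
apply: le_trans (pa x); rewrite oppr_le0 mulr_ge0 ?redot_ge0 //; exact: ltW.
Qed.

(** [a - a ^+ 2 = (1 - a) a (1 - a) + a (1 - a) a] when [0 <= a <= 1]. *)
Lemma op_le1_sq a x : op_ge0 a -> (forall x, ip (a x) x <= ip x x) ->
  ip (a x) (a x) <= ip (a x) x.
Proof.
move=> [sA pa] h.
have := pa (x - a x); have := h (a x).
have E : ip (a (a x)) x = ip (a x) (a x) by rewrite sA.
rewrite appBr /= !(redotDl, redotDr, redotNl, redotNr) E.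
move: (ip (a x) (a x)) (ip (a x) x) (ip (a (a x)) (a x)) => p q s l1 l2; lra.
Qed.

(** What is needed of the self-adjoint members of the von Neumann algebra
generated by [T].  The three properties are stable under sums, products and
strong limits, and compose ([gen_trans]). *)
Definition generated T a := [/\ selfadj a, (forall c, c * T = T * c -> c * a = a * c) &
  forall s, symmetry s -> s T = T -> s a = a].

Local Notation gen := generated.

Lemma gen_refl T : selfadj T -> gen T T. Proof. by []. Qed.
Lemma gen_comm T a b : gen T a -> gen T b -> a * b = b * a.
Proof.
move=> [_ ca _] [_ cb _]; apply: cb; apply/esym; exact: ca.
Qed.
Lemma gen_trans T a b : gen T a -> gen a b -> gen T b.
Proof.
by move=> [_ ca sA] [hb cb sb]; split=> // [c /ca/cb|s hs sT] //; apply: sb => //; apply: sA.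
Qed.
Lemma gen1 T : gen T 1.
Proof. by split=> [|c _|s hs _]; rewrite ?mulr1 ?mul1r // (sym1 hs). Qed.
Lemma genD T a b : gen T a -> gen T b -> gen T (a + b).
Proof.
move=> [ha ca sA] [hb cb sb]; split=> [|c h|s hs h]; first exact: selfadjD.
  by rewrite mulrDl mulrDr ca // cb.
by rewrite (symD hs) sA // sb.
Qed.
Lemma genZ T r a : gen T a -> gen T (r *: a).
Proof.
move=> [ha ca sA]; split=> [|c h|s hs h]; first exact: selfadjZ.
  by rewrite -vscaleAl -vscaleAr ca.
by rewrite (symZ hs) sA.
Qed.
Lemma genN T a : gen T a -> gen T (- a).
Proof. by rewrite -scaleN1r; apply: genZ. Qed.
Lemma genB T a b : gen T a -> gen T b -> gen T (a - b).
Proof. by move=> h h'; apply: genD => //; apply: genN. Qed.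
Lemma gen0 T : gen T 0.
Proof. by rewrite -(subrr 1); apply: genB; apply: gen1. Qed.
Lemma genM T a b : gen T a -> gen T b -> gen T (a * b).
Proof.
move=> na nb; have ab := gen_comm na nb; move: na nb => [ha ca sA] [hb cb sb].
split=> [|c h|s hs h]; first exact: selfadjM.
  by rewrite mulrA ca // -mulrA cb // mulrA.
by case: (symM hs) => ->; rewrite sA // sb.
Qed.
Lemma genX T a n : gen T a -> gen T (a ^+ n).
Proof.
by move=> h; elim: n => [|n IH]; [exact: gen1|rewrite exprS; apply: genM].
Qed.

Lemma strong_lim_app u a c x : strong_lim u a -> scvg (fun n => c (u n x)) (c (a x)).
Proof.
move=> h; have [k k0 hk] := norm_le_ex c.
apply: (@scvg_squeeze _ _ _ _ (fun n => k * N (u n x - a x))) => [n|].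
  by rewrite -appBr.
by rewrite -(mulr0 k); apply: cvgMr; apply: h.
Qed.

Lemma strong_limM u v a b k : 0 <= k -> (forall n, norm_le k (u n)) -> strong_lim u a -> strong_lim v b ->
  strong_lim (fun n => u n * v n) (a * b).
Proof.
move=> k0 hk ua vb x.
apply: (@scvg_squeeze _ _ _ _ (fun n => k * N (v n x - b x) + N (u n (b x) - a (b x)))) => [n|].
  rewrite !appM (_ : u n (v n x) - _ = u n (v n x - b x) + (u n (b x) - a (b x))).
    by apply: (le_trans (renormD _ _)); rewrite lerD2r; apply: hk.
  by rewrite appBr addrA subrK.
have -> : (0 : R) = k * 0 + 0 by rewrite mulr0 addr0.
by apply: cvgD; [apply: cvgMr; apply: vb|apply: ua].
Qed.

Lemma gen_lim T u a : (forall n, gen T (u n)) -> strong_lim u a -> gen T a.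
Proof.
move=> hu ua; split.
- move=> x y.
  have h1 := scvg_ip hdot (y := y) (ua x).
  have h2 := scvg_ip hdot (y := x) (ua y).
  rewrite (redotC dot x); apply: (cvg_unique (@Rhausdorff R) h1).
  apply: cvg_trans h2; apply: near_eq_cvg; near=> n.
  by have [-> _ _] := hu n; rewrite redotC.
- move=> c cT; apply: vN_ext => x; rewrite !appM.
  apply: (scvg_uniq hdot (strong_lim_app c x ua)).
  have := ua (c x); congr (scvg _ _); apply: funext => n.
  by have [_ cu _] := hu n; rewrite -!appM cu.
- by move=> s hs sT; apply: (sym_lim hs ua) => n; have [_ _ ->] := hu n.
Unshelve. all: by end_near. Qed.

(** A difference [D = u n - u m] satisfies [0 <= D <= 1], hence [op_le1_sq]
bounds [|D x| ^+ 2] by the increment of the convergent real sequence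
[ip (u n x) x]. *)
Lemma monotone_limit T (u : nat -> V) : (forall n, gen T (u n)) ->
  (forall n x, 0 <= ip (u n x) x) -> (forall n x, ip (u n x) x <= ip (u n.+1 x) x) ->
  (forall n x, ip (u n x) x <= ip x x) ->
  exists a, [/\ gen T a, strong_lim u a & norm_le 1 a].
Proof.
move=> nu u0 um u1.
have hb n : norm_le 1 (u n).
  by apply: norm_le_op_ge0 => // [|x]; [split=> //; have [] := nu n|rewrite mul1r].
suff [a ba ua] : exists2 a, norm_le 1 a & strong_lim u a.
  by exists a; split=> //; apply: gen_lim ua.
apply: strong_lim_ex => // x; apply: (scvg_complete) => e e0.
pose q n := ip (u n x) x.
have qm : nondecreasing_seq q by apply/nondecreasing_seqP => n; exact: um.
have qc : cvgn q.
  apply: nondecreasing_is_cvgn => //; exists (ip x x) => _ [n _ <-]; exact: u1.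
have ql n : q n <= limn q by apply: nondecreasing_cvgn_le.
have e2 : 0 < e ^+ 2 by rewrite exprn_gt0.
move/cvgrPdist_lt : qc => /(_ _ e2) [n0 _ hn0].
have key m n : (n0 <= m)%N -> (m <= n)%N -> N (u m x - u n x) <= e.
  move=> hm mn.
  have D1 : op_ge0 (u n - u m).
    split; first by apply: selfadjB; [have [] := nu n|have [] := nu m].
    move=> y; rewrite appB redotBl subr_ge0.
    have : nondecreasing_seq (fun k => ip (u k y) y) by apply/nondecreasing_seqP.
    exact.
  have := @op_le1_sq _ x D1; rewrite appB redotxx // => h.
  rewrite renorm_distC -(@ler_pXn2r _ 2) ?nnegrE ?renorm_ge0 ?(ltW e0) //.
  apply: (le_trans (h _)) => [y|].
    by rewrite appB redotBl lerBlDr (le_trans (u1 n y)) // lerDl.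
  rewrite redotBl -/(q n) -/(q m).
  have := hn0 m hm; have := ql n; have := ql m => /=.
  move=> l1 l2; rewrite ger0_norm ?subr_ge0 //; lra.
exists n0 => m n hm hn; have [mn|/ltnW nm] := leqP m n; first exact: key.
by rewrite renorm_distC key.
Qed.

(** The polynomials in [z] with nonnegative coefficients, in Horner form.  For
[z >= 0] they are positive operators closed under products; this replaces the
theorem that a product of commuting positive operators is positive, whose usual
proof relies on square roots. *)
Inductive nneg_poly (z : V) : V -> Prop :=
| NnegPoly0 : nneg_poly z 0
| NnegPolyS r p : 0 <= r -> nneg_poly z p -> nneg_poly z ((r *: (1 : V) : V) + z * p).

Lemma nneg_polyD z p q : nneg_poly z p -> nneg_poly z q -> nneg_poly z (p + q).
Proof.
move=> hp; elim: hp q => [|r p' r0 hp IH] q hq; first by rewrite add0r.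
case: hq => [|s q' s0 hq]; first by rewrite addr0; apply: NnegPolyS.
rewrite addrACA -scalerDl -mulrDr; apply: NnegPolyS; first exact: addr_ge0.
exact: IH.
Qed.

Lemma nneg_polyZ z r p : 0 <= r -> nneg_poly z p -> nneg_poly z (r *: p).
Proof.
move=> r0; elim=> [|s q s0 hq IH]; first by rewrite scaler0; exact: NnegPoly0.
by rewrite scalerDr scalerA vscaleAr; apply: NnegPolyS => //; rewrite mulr_ge0.
Qed.

Lemma nneg_polyMl z p : nneg_poly z p -> nneg_poly z (z * p).
Proof. by move=> h; rewrite -[_ * _]add0r -(scale0r (1 : V)); apply: NnegPolyS. Qed.

Lemma nneg_polyM z p q : nneg_poly z p -> nneg_poly z q -> nneg_poly z (p * q).
Proof.
move=> hp hq; elim: hp => [|r p' r0 hp IH]; first by rewrite mul0r; exact: NnegPoly0.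
rewrite mulrDl -vscaleAl mul1r -mulrA; apply: nneg_polyD; first exact: nneg_polyZ.
exact: nneg_polyMl.
Qed.

Lemma nneg_polyC z r : 0 <= r -> nneg_poly z (r *: (1 : V)).
Proof.
by move=> r0; rewrite -[_ *: _]addr0 -(mulr0 z); apply: NnegPolyS => //; exact: NnegPoly0.
Qed.

Lemma nneg_poly_id z : nneg_poly z z.
Proof. by rewrite -[X in nneg_poly _ X]mulr1 -(scale1r (1 : V)); apply/nneg_polyMl/nneg_polyC. Qed.

Lemma nneg_poly_gen T z p : gen T z -> nneg_poly z p -> gen T p.
Proof.
move=> hz; elim=> [|r q r0 _ IH]; first exact: gen0.
by apply: genD; [apply: genZ; exact: gen1|apply: genM].
Qed.

(** The induction needs the stronger claim that all [z ^+ k * p] are positive. *)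
Lemma nneg_poly_ge0 z p : op_ge0 z -> nneg_poly z p -> op_ge0 p.
Proof.
move=> hz hp; rewrite -[p]mul1r -(expr0 z).
elim: hp (0%N) => [|r q r0 _ IH] k; first by rewrite mulr0; exact: op_ge00.
rewrite mulrDr -vscaleAr mulr1 mulrA -exprSr; apply: op_ge0D => //.
by apply: op_ge0Z => //; exact: op_ge0X.
Qed.

(** [1 - y] is the square root of [1 - z].  The iterates of
[y |-> (z + y ^+ 2) / 2] from [0] increase, because
[2 (y'' - y') = (y' + y) (y' - y)] for successive iterates [y], [y'], [y''],
and the increments remain polynomials with nonnegative coefficients. *)
Lemma sqrt_one_sub T z : gen T z -> op_ge0 z -> (forall x, ip (z x) x <= ip x x) ->
  exists y, [/\ gen T y, norm_le 1 y & y + y = z + y * y].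
Proof.
move=> nz pz z1.
pose y n : V := iter n (fun y => 2^-1 *: (z + y * y)) (0 : V).
have yS n : y n.+1 = 2^-1 *: (z + y n * y n) by [].
have cy n : nneg_poly z (y n).
  elim: n => [|n IH]; first exact: NnegPoly0.
  by rewrite yS; apply: nneg_polyZ; rewrite ?invr_ge0 //; apply: nneg_polyD; [exact: nneg_poly_id|exact: nneg_polyM].
have ny n := nneg_poly_gen nz (cy n).
have py n := nneg_poly_ge0 pz (cy n).
have cd n : nneg_poly z (y n.+1 - y n).
  elim: n => [|n IH]; first by rewrite subr0; exact: cy.
  rewrite {1}(yS n.+1) {3}(yS n) -scalerBr opprD addrACA subrr add0r.
  have -> : y n.+1 * y n.+1 - y n * y n = (y n.+1 + y n) * (y n.+1 - y n).
    by rewrite mulrDl !mulrBr (gen_comm (ny n.+1) (ny n)) addrA subrK.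
  by apply: nneg_polyZ; rewrite ?invr_ge0 //; apply: nneg_polyM => //; apply: nneg_polyD.
have y1 n x : ip (y n x) x <= ip x x.
  elim: n x => [|n IH] x; first by rewrite app0 redot0l redot_ge0.
  rewrite yS appZ redotZl appD redotDl appM.
  have b1 : norm_le 1 (y n) by apply: norm_le_op_ge0 => // w; rewrite mul1r.
  have := (norm_leP hdot (y n) ler01).1 b1 x; rewrite expr1n mul1r.
  have E : ip (y n (y n x)) x = ip (y n x) (y n x) by have [h _ _] := ny n; rewrite h.
  rewrite E; have := z1 x; lra.
have [a [na ya ba]] := monotone_limit ny (fun n x => (py n).2 x)
  (fun n x => ltac:(by rewrite -subr_ge0 -redotBl -appB; exact: (nneg_poly_ge0 pz (cd n)).2)) y1.
exists a; split=> //.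
have b1 n : norm_le 1 (y n) by apply: norm_le_op_ge0 => // w; rewrite mul1r.
have h1 := strong_limM ler01 b1 ya ya.
have E : a = 2^-1 *: (z + a * a).
  apply: (strong_lim_uniq hdot (u := fun n => y n.+1)).
    by move=> x; exact: (scvg_S (ya x)).
  move=> x; rewrite appZ appD; apply: scvgZ; apply: scvgD; first exact: scvg_cst.
  exact: h1.
rewrite {1 2}E -scalerDl (_ : 2^-1 + 2^-1 = 1 :> R); last lra.
by rewrite scale1r.
Qed.

Lemma op_sqrt T a : gen T a -> op_ge0 a -> exists b, [/\ gen T b, op_ge0 b & b * b = a].
Proof.
move=> na pa; have [k k0 hk] := norm_le_ex a.
pose z : V := 1 - k^-1 *: a.
have nz : gen T z by apply: genB; [exact: gen1|exact: genZ].
have zx x : ip (z x) x = ip x x - k^-1 * ip (a x) x by rewrite appB redotBl appZ redotZl.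
have [||y [ny by1 yE]] := sqrt_one_sub nz.
- split=> [|x]; first by have [] := nz.
  by rewrite zx subr_ge0 ler_pdivrMl //; exact: redot_norm_le.
- by move=> x; rewrite zx gerBl mulr_ge0 ?invr_ge0 ?(ltW k0) ?pa.2.
exists (Num.sqrt k *: (1 - y)); split.
- by apply: genZ; apply: genB => //; exact: gen1.
- apply: op_ge0Z; first exact: sqrtr_ge0.
  split=> [|x]; first by apply: selfadjB => //; have [] := ny.
  by rewrite appB redotBl subr_ge0 (le_trans (redot_norm_le x by1)) // mul1r.
rewrite -vscaleAl -vscaleAr scalerA -expr2 sqr_sqrtr ?(ltW k0) //.
have -> : (1 - y) * (1 - y) = 1 - (y + y) + y * y.
  by rewrite mulrBr mulr1 mulrBl mul1r opprB !addrA opprD addrA; rewrite addrAC -!addrA; congr (_ + _); rewrite addrCA addrA addrC addrA.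
rewrite yE opprD addrA subrK /z opprB addrCA subrr addr0.
by rewrite scalerA divff ?scale1r // gt_eqF.
Qed.

(** With [z = 1 - (w / k) ^+ 2] for a bound [k] of [w], the powers of [z]
decrease to the projection on the fixed vectors of [z], which are the kernel of
[w].  The last clause says that [1 - Q] projects on the closure of the range of
[w]: [1 - z ^+ n] is a multiple of [w]. *)
Lemma kernel_projection T w : gen T w -> exists Q, [/\ gen T Q, Q * Q = Q, w * Q = 0,
  forall x, w x = 0 -> Q x = x & 
  forall x e, 0 < e -> exists y, N (x - Q x - w y) <= e].
Proof.
move=> nw; have [k k0 hk] := norm_le_ex w.
have sw : selfadj w by have [] := nw.
pose z : V := 1 - (k ^+ 2)^-1 *: (w * w).
have k2 : 0 < k ^+ 2 by rewrite exprn_gt0.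
have nz : gen T z by apply: genB; [exact: gen1|apply: genZ; exact: genM].
have zx x : ip (z x) x = ip x x - (k ^+ 2)^-1 * ip (w x) (w x).
  by rewrite appB redotBl appZ redotZl appM sw.
have pz : op_ge0 z.
  split=> [|x]; first by have [] := nz.
  by rewrite zx subr_ge0 ler_pdivrMl //; exact: (norm_leP hdot w (ltW k0)).1 hk x.
have p1z : op_ge0 (1 - z).
  split=> [|x]; first by apply: selfadjB => //; have [] := nz.
  by rewrite appB redotBl zx opprB addrCA subrr addr0 mulr_ge0 ?redot_ge0 // invr_ge0 ltW.
have nX n : gen T (z ^+ n) by exact: genX.
have dz n : op_ge0 (z ^+ n - z ^+ n.+1).
  have -> : z ^+ n - z ^+ n.+1 = z ^+ n * (1 - z) by rewrite mulrBr mulr1 exprSr.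
  have [b [nb pb <-]] := op_sqrt (genB (gen1 T) nz) p1z.
  rewrite mulrA (gen_comm (nX n) nb); apply: op_ge0_conj; first exact: pb.1.
  exact: op_ge0X.
have z1 n x : 0 <= ip ((1 - z ^+ n : V) x) x.
  elim: n => [|n IH]; first by rewrite expr0 subrr app0 redot0l.
  have := (dz n).2 x; move: IH; rewrite !appB !redotBl; lra.
have [|||a [na ua ba]] := @monotone_limit T (fun n => 1 - z ^+ n) _ z1.
- by move=> n; apply: genB => //; exact: gen1.
- by move=> n x; have := (dz n).2 x; rewrite !appB !redotBl; lra.
- by move=> n x; rewrite appB redotBl gerBl (op_ge0X n pz).2.
have uQ : strong_lim (fun n => z ^+ n) (1 - a).
  move=> x; have := scvgD (scvg_cst x) (scvgZ (-1) (ua x)).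
  congr (scvg _ _); last by rewrite scaleN1r.
  by apply: funext => n; rewrite scaleN1r appB app1 opprB addrC subrK.
have zQ : z * (1 - a) = 1 - a.
  apply: (strong_lim_uniq hdot (u := fun n => z ^+ n.+1)); last by move=> x; exact: (scvg_S (uQ x)).
  by move=> x; have := strong_lim_app z x uQ; congr (scvg _ _); apply: funext => n; rewrite exprS.
have zXQ n : z ^+ n * (1 - a) = 1 - a.
  by elim: n => [|n IH]; rewrite ?mul1r // exprSr -mulrA zQ.
exists (1 - a); split.
- by apply: genB => //; exact: gen1.
- apply: (strong_lim_uniq hdot (u := fun n => z ^+ n * (1 - a))) => x.
    by rewrite appM; exact: uQ.
  rewrite (_ : (fun n => _) = fun=> app (1 - a) x); first exact: scvg_cst.
  by apply: funext => n; rewrite zXQ.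
- apply: vN_ext => x; rewrite appM app0; apply: renorm_eq0; apply/eqP.
  rewrite -sqrf_eq0 -(redotxx hdot) -sw -appM.
  have h : app ((k ^+ 2)^-1 *: (w * w) : V) (app (1 - a) x) = 0.
    apply: (@subrI _ (app (1 - a) x)); rewrite subr0.
    by have /(congr1 (fun b : V => app b x)) := zQ.
  have : (k ^+ 2)^-1 * ip (app (w * w) (app (1 - a) x)) (app (1 - a) x) = 0.
    by rewrite -redotZl -appZ h redot0l.
  by move/eqP; rewrite mulf_eq0 invr_eq0 gt_eqF.
- move=> x wx0; have zx' : z x = x by rewrite /z appB appZ appM wx0 app0r scaler0 subr0.
  apply: (scvg_uniq hdot (uQ x)).
  rewrite (_ : (fun n => _) = fun=> x); first exact: scvg_cst.
  by apply: funext => n; elim: n => [|n IH] //; rewrite exprSr appM zx'.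
- move=> x e e0.
  have hg n : exists g : V, 1 - z ^+ n = w * g.
    elim: n => [|n [g gE]]; first by exists 0; rewrite expr0 subrr mulr0.
    exists ((k ^+ 2)^-1 *: w + z * g).
    rewrite mulrDr -vscaleAr mulrA (gen_comm nw nz) -mulrA -gE mulrBr mulr1 -exprS.
    by rewrite addrA; congr (_ - _); rewrite /z addrCA subrr addr0.
  have /cvgrPdist_le /(_ _ e0) [n _ /(_ n (leqnn _))] := ua x.
  rewrite sub0r normrN ger0_norm ?renorm_ge0 // => hn.
  have [g gE] := hg n; exists (g x); rewrite -appM -gE renorm_distC.
  by rewrite (appB 1 a) app1 subKr.
Qed.

(** With [y = |T|], the square root of [T ^+ 2], one has
[(y + T) (y - T) = 0].  Let [Q] project on the kernel of [y + T]: there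
[T = - y <= 0], and on the complement [T = y >= 0] since the range of [y - T]
is contained in that kernel. *)
Lemma spectral_projection T : selfadj T -> exists P, [/\ gen T P, P * P = P,
  forall x, 0 <= ip (T (P x)) (P x) & forall x, ip (T (x - P x)) (x - P x) <= 0].
Proof.
move=> sT; have nT := gen_refl sT.
have [y [ny py yE]] := op_sqrt (genM nT nT) (op_ge0_sqr sT).
have nw : gen T (y + T) by apply: genD.
have [Q [nQ QQ wQ kQ _]] := kernel_projection nw.
have nP : gen T (1 - Q) by apply: genB => //; exact: gen1.
exists (1 - Q); split=> //.
- by rewrite mulrBr mulr1 mulrBl mul1r QQ subrr subr0.
- move=> x; set v := app (1 - Q) x.
  suff -> : T v = y v by exact: py.2.
  apply/eqP; rewrite -subr_eq0 -opprB oppr_eq0 -appB; apply/eqP.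
  have h1 : (1 - Q) * (y - T) = 0.
    apply: vN_ext => u; rewrite appM (appB 1 Q) app1; apply/eqP; rewrite subr_eq0; apply/eqP/esym.
    apply: kQ; rewrite -appM mulrDl !mulrBr yE (gen_comm ny nT).
    by rewrite addrA subrK subrr.
  rewrite /v -appM -(gen_comm nP) ?h1 //; exact: genB.
- move=> x; rewrite appB app1 subKr.
  have -> : T (Q x) = - y (Q x).
    by apply/eqP; rewrite -addr_eq0 addrC -appD -appM wQ.
  by rewrite redotNl oppr_le0; exact: py.2.
Qed.

(** The Neumann series of [g / 2 = 1 - d], divided by [4] so that its partial
sums stay below [1].  Halving [g] makes [d] positive, hence the partial sums
monotone. *)
Lemma op_inverse T g : gen T g -> norm_le (1/2) (1 - g) -> exists2 h, gen T h & g * h = 1.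
Proof.
move=> ng hg; pose d : V := 1 - 2^-1 *: g.
have nd : gen T d by apply: genB; [exact: gen1|exact: genZ].
have dx x : ip (d x) x = ip x x - 2^-1 * ip (g x) x by rewrite appB redotBl appZ redotZl.
have l1 x : ip x x - ip (g x) x <= 1 / 2 * ip x x.
  by have := redot_norm_le x hg; rewrite appB redotBl.
have l2 x : - (1 / 2 * ip x x) <= ip x x - ip (g x) x.
  by have := redot_norm_geN x hg; rewrite appB redotBl.
have pd : op_ge0 d.
  split=> [|x]; first by have [] := nd.
  by rewrite dx; have := l1 x; have := l2 x; have := redot_ge0 hdot x; lra.
have bd3 : norm_le (3/4) d.
  apply: norm_le_op_ge0 => // x.
  by rewrite dx; have := l1 x; have := l2 x; have := redot_ge0 hdot x; lra.
pose u n : V := iter n (fun b => (4^-1 *: (1 : V) : V) + d * b) (0 : V).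
have uS n : u n.+1 = (4^-1 *: (1 : V) : V) + d * u n by [].
have cu n : nneg_poly d (u n).
  by elim: n => [|n IH]; [exact: NnegPoly0|rewrite uS; apply: NnegPolyS; rewrite ?invr_ge0].
have cd n : nneg_poly d (u n.+1 - u n).
  elim: n => [|n IH]; first by rewrite subr0; exact: cu.
  by rewrite {1}uS {2}uS opprD addrACA subrr add0r -mulrBr; apply: nneg_polyMl.
have bu n : norm_le 1 (u n).
  elim: n => [|n IH] x; first by rewrite app0 renorm0 mulr_ge0 ?renorm_ge0.
  rewrite uS appD appZ appM; apply: (le_trans (renormD _ _)); rewrite renormZ app1.
  have := bd3 (u n x); have := IH x; rewrite ger0_norm ?invr_ge0 //.
  have := renorm_ge0 x; lra.
have nu n := nneg_poly_gen nd (cu n).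
have [|||a [na ua ba]] := @monotone_limit T u nu.
- by move=> n x; exact: (nneg_poly_ge0 pd (cu n)).2.
- by move=> n x; rewrite -subr_ge0 -redotBl -appB; exact: (nneg_poly_ge0 pd (cd n)).2.
- by move=> n x; rewrite -[leRHS]mul1r; exact: redot_norm_le.
have E : a = (4^-1 *: (1 : V) : V) + d * a.
  apply: (strong_lim_uniq hdot (u := fun n => u n.+1)) => x; first exact: (scvg_S (ua x)).
  rewrite appD; apply: (scvgD (u := fun=> app (4^-1 *: (1 : V) : V) x)); first exact: scvg_cst.
  by rewrite appM; apply: strong_lim_app.
exists (2 *: a); first exact: genZ.
have : 2^-1 *: (g * a) = 4^-1 *: (1 : V).
  move: E; rewrite /d mulrBl mul1r addrCA -[X in X = _]addr0 => /addrI/esym/eqP.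
  by rewrite subr_eq0 eq_sym -vscaleAl => /eqP.
move/(congr1 (fun b => 4 *: b)); rewrite !scalerA divff ?scale1r // -vscaleAr => <-.
by congr (_ *: _); lra.
Qed.

End Spectral.

(** * Symmetries, pinchings and separated projections *)

Section Perturbation.
Variables (R : realType) (H : completeNormedModType R[i]).
Variable dot : {dot H for (conjC : R[i] -> R[i])}.
Variable A : set (H -> H).
Hypothesis hdot : hilbert dot.
Variable hA : von_neumann_algebra dot A.

Local Notation ip := (redot dot).
Local Notation N := (@renorm R H).
Local Notation V := (vN hA).
Local Notation st := (star hdot).
Local Notation symmetry := (vn_symmetry hdot).
Local Notation gen := (generated hdot).

Implicit Types a b c e T : V.

Lemma norm_le_star k a : 0 <= k -> norm_le k a -> norm_le k (st a).
Proof.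
move=> k0 h x; have [/eqP|n0] := eqVneq (N (st a x)) 0.
  by move=> /eqP ->; rewrite mulr_ge0 ?renorm_ge0.
have np : 0 < N (st a x) by rewrite lt0r n0 renorm_ge0.
rewrite -(ler_pM2l np) -expr2 -(redotxx hdot).
have -> : ip (st a x) (st a x) = ip (a (st a x)) x by rewrite (redot_star hdot a).
by apply: (le_trans (redot_CS hdot _ _)); rewrite mulrCA mulrA ler_wpM2r ?renorm_ge0.
Qed.

Lemma norm_le_trans k l a b c : norm_le k (a - b) -> norm_le l (b - c) -> norm_le (k + l) (a - c).
Proof. by move=> h h'; rewrite -(subrK b a) -addrA; apply: norm_leD. Qed.

Lemma proj_norm_le1 e : selfadj e -> e * e = e -> norm_le 1 e.
Proof.
move=> se ee; apply: norm_le_op_ge0 => // [|x].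
  by rewrite -ee; apply: op_ge0_sqr.
have h : ip (e x) x = ip (e x) (e x) by rewrite -se -appM ee.
have := redot_ge0 hdot (x - e x).
rewrite redotBl !redotBr (redotC dot x (e x)) -h; lra.
Qed.

Section Sym.
Variables (s : V -> V) (hs : symmetry s).

Lemma sym0 : s 0 = 0.
Proof. by apply: (addrI (s 0)); rewrite -(symD hs) !addr0. Qed.
Lemma symN a : s (- a) = - s a.
Proof. by rewrite -scaleN1r (symZ hs) scaleN1r. Qed.
Lemma symB a b : s (a - b) = s a - s b.
Proof. by rewrite (symD hs) symN. Qed.
Lemma sym_sum I (r : seq I) (P : pred I) (F : I -> V) :
  s (\sum_(i <- r | P i) F i) = \sum_(i <- r | P i) s (F i).
Proof. by elim/big_rec2: _ => [|i x y _ <-]; [exact: sym0|exact: symD]. Qed.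
Lemma sym_selfadj a : selfadj a -> selfadj (s a).
Proof. by move=> /(selfadjP hdot) h; apply/(selfadjP hdot); rewrite -(sym_star hs) h. Qed.
Lemma sym_conj b a : s (b * a * b) = s b * s a * s b.
Proof. by case: (symM hs) => h; rewrite !h // mulrA. Qed.
Lemma sym_comm a b : a * b = b * a -> s (a * b) = s a * s b.
Proof. by case: (symM hs) => [h _|h ->]; rewrite h. Qed.
Lemma sym_commC a b : a * b = b * a -> s a * s b = s b * s a.
Proof. by move=> ab; rewrite -!sym_comm // ab. Qed.
Lemma sym_sqr a : s (a * a) = s a * s a.
Proof. exact: sym_comm. Qed.

(** Symmetries preserve squares of self-adjoint elements, and every positive
element is such a square. *)
Lemma sym_op_ge0 a : op_ge0 a -> op_ge0 (s a).
Proof.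
move=> pa; have [b [[sb _ _] _ <-]] := op_sqrt (gen_refl hdot pa.1) pa.
by rewrite sym_sqr; apply: op_ge0_sqr => //; exact: sym_selfadj.
Qed.

(** A bound [k] of [a] is the positivity of [k ^+ 2 - st a * a]; an
antimultiplicative symmetry turns it into the same bound for [st (s a)], so
that case starts from [st a]. *)
Lemma sym_norm_le k a : 0 <= k -> norm_le k a -> norm_le k (s a).
Proof.
move=> k0 h.
have key c : norm_le k c -> op_ge0 (k ^+ 2 *: (1 : V) - st c * c).
  move=> hc; split=> [|x].
    apply: selfadjB; first by apply: selfadjZ.
    by apply/(selfadjP hdot); rewrite starM starK.
  rewrite appB appZ app1 appM redotBl redotZl [ip (st c _) _]redotC -redot_star subr_ge0.
  exact: (norm_leP hdot c k0).1 hc x.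
have un c : op_ge0 (k ^+ 2 *: (1 : V) - st c * c) -> norm_le k c.
  move=> [_ hc]; apply/(norm_leP hdot) => // x.
  by have := hc x; rewrite appB appZ app1 appM redotBl redotZl [ip (st c _) _]redotC -redot_star subr_ge0.
case: (symM hs) => hM.
  have := sym_op_ge0 (key _ h); rewrite symB (symZ hs) (sym1 hs) hM (sym_star hs); exact: un.
have := sym_op_ge0 (key _ (norm_le_star k0 h)).
rewrite symB (symZ hs) (sym1 hs) starK hM (sym_star hs); exact: un.
Qed.

End Sym.

Section Family.
Variables (I : finType) (p : I -> V).
Hypothesis psa : forall i, selfadj (p i).
Hypothesis porth : forall i j, p i * p j = if i == j then p i else 0.

Lemma psum_l i : p i * (\sum_j p j) = p i.
Proof.
rewrite mulr_sumr (bigD1 i) //= porth eqxx big1 ?addr0 // => j ji.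
by rewrite porth eq_sym (negbTE ji).
Qed.

Lemma psum_r i : (\sum_j p j) * p i = p i.
Proof.
rewrite mulr_suml (bigD1 i) //= porth eqxx big1 ?addr0 // => j ji.
by rewrite porth (negbTE ji).
Qed.

Lemma psum_selfadj : selfadj (\sum_j p j).
Proof. by apply: selfadj_sum => i _; exact: psa. Qed.

Lemma psum_proj : (\sum_j p j) * (\sum_j p j) = \sum_j p j.
Proof. by rewrite {1}mulr_suml; apply: eq_bigr => i _; exact: psum_l. Qed.

Lemma redot_suml (J : finType) (F : J -> H) x : ip (\sum_j F j) x = \sum_j ip (F j) x.
Proof. by elim/big_rec2: _ => [|j u v _ <-]; rewrite ?redot0l ?redotDl. Qed.
Lemma redot_sumr (J : finType) (F : J -> H) x : ip x (\sum_j F j) = \sum_j ip x (F j).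
Proof. by rewrite redotC redot_suml; apply: eq_bigr => j _; rewrite redotC. Qed.

Lemma pythagoras (u : I -> H) :
  ip (\sum_i p i (u i)) (\sum_i p i (u i)) = \sum_i ip (p i (u i)) (p i (u i)).
Proof.
rewrite redot_suml; apply: eq_bigr => i _.
rewrite redot_sumr (bigD1 i) //= big1 ?addr0 // => j ji.
by rewrite psa -appM porth eq_sym (negbTE ji) app0 redot0r.
Qed.

Lemma bessel x : \sum_i ip (p i x) (p i x) <= ip x x.
Proof.
rewrite -pythagoras -app_sum.
by have := (norm_leP hdot _ ler01).1 (proj_norm_le1 psum_selfadj psum_proj) x; rewrite expr1n mul1r.
Qed.

(** The vectors [p i (b (p i x))] are orthogonal, and Bessel's inequality sums
the squares of the [p i x]. *)
Lemma pinch_norm_le k b : 0 <= k -> norm_le k b -> norm_le k (\sum_i p i * b * p i).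
Proof.
move=> k0 hb; apply/(norm_leP hdot) => // x.
rewrite app_sum.
have -> : \sum_i app (p i * b * p i) x = \sum_i p i (b (p i x)) by [].
rewrite pythagoras; apply: le_trans (_ : k ^+ 2 * \sum_i ip (p i x) (p i x) <= _).
  rewrite mulr_sumr; apply: ler_sum => i _.
  have pp : norm_le 1 (p i) by apply: proj_norm_le1 => //; rewrite porth eqxx.
  apply: le_trans ((norm_leP hdot b k0).1 hb (p i x)).
  by have := (norm_leP hdot _ ler01).1 pp (b (p i x)); rewrite expr1n mul1r.
by rewrite ler_wpM2l ?bessel // exprn_ge0.
Qed.

Lemma pinch_comm b : (forall i, p i * b = b * p i) ->
  \sum_i p i * b * p i = b * \sum_i p i.
Proof.
by move=> h; rewrite mulr_sumr; apply: eq_bigr => i _; rewrite h -mulrA porth eqxx.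
Qed.

(** The pinching of [b'] is exactly [b' * \sum_i p i], so the error only involves
[b' - b], once inside the pinching and once outside. *)
Lemma pinch_near k b b' : 0 <= k -> (forall i, p i * b' = b' * p i) -> norm_le k (b' - b) ->
  norm_le (k + k) (\sum_i p i * b * p i - b * \sum_i p i).
Proof.
move=> k0 hc hb.
have -> : \sum_i p i * b * p i - b * \sum_i p i =
  (b' - b) * (\sum_i p i) - \sum_i p i * (b' - b) * p i.
  have -> : \sum_i p i * (b' - b) * p i =
    \sum_i p i * b' * p i - \sum_i p i * b * p i.
    by rewrite -sumrB; apply: eq_bigr => i _; rewrite mulrBr mulrBl.
  by rewrite (pinch_comm hc) mulrBl opprB [RHS]addrC addrA subrK.
apply: norm_leB; last exact: pinch_norm_le.
by rewrite -[k]mulr1; apply: norm_leM => //; apply: proj_norm_le1 psum_selfadj psum_proj.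
Qed.

End Family.

(** The product [Z = E * F] solves the Sylvester equation
[(k + X) Z - Z (k + Y) = E (X - Y) F].  For a large shift [k], [k + X] is at
least [k + m] on the range of [E], whereas [k + Y] lies between [0] and [k - m]
on the range of [F].  Hence [(k + m) |Z| <= d + (k - m) |Z|]. *)
Lemma separated_norm_le (E F X Y : V) (m d : R) : 0 < m -> 0 <= d ->
  selfadj E -> E * E = E -> selfadj F -> F * F = F -> selfadj X -> selfadj Y ->
  E * X = X * E -> F * Y = Y * F ->
  (forall x, m * ip (E x) (E x) <= ip (X (E x)) (E x)) ->
  (forall x, ip (Y (F x)) (F x) <= - (m * ip (F x) (F x))) ->
  norm_le d (X - Y) -> norm_le (d / (2 * m)) (E * F).
Proof.
move=> m0 d0 sE EE sF FF sX sY EX FY hE hF hd.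
have [k' k'0 hk'] := norm_le_ex Y.
pose k := k' + m.
have km : m < k by rewrite ltrDr.
have hk : norm_le k Y by apply: norm_leW hk'; rewrite lerDl ltW.
pose c := opnorm (E * F : V).
have hc : norm_le c (E * F) by apply: norm_le_opnorm.
suff : c <= d / (2 * m) by move=> h; apply: norm_leW h hc.
have Eb := proj_norm_le1 sE EE; have Fb := proj_norm_le1 sF FF.
have c0 : 0 <= c by exact: opnorm_ge0.
have FGC : F * (k *: (1 : V) + Y) = (k *: (1 : V) + Y) * F.
  by rewrite mulrDr mulrDl FY -vscaleAr -vscaleAl mulr1 mul1r.
have hG : norm_le (k - m) ((k *: (1 : V) + Y) * F).
  have E1 : (k *: (1 : V) + Y) * F = F * (k *: (1 : V) + Y) * F.
    by rewrite FGC -mulrA FF.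
  apply: (norm_le_op_ge0 hdot); first by rewrite subr_gt0.
    rewrite E1; split=> [|x].
      by apply: selfadj_conj => //; apply: selfadjD => //; apply: selfadjZ.
    rewrite !appM sF appD appZ app1 redotDl redotZl.
    by have := redot_norm_geN hdot (F x) hk; lra.
  move=> x; rewrite E1 !appM sF appD appZ app1 redotDl redotZl.
  have := hF x.
  have : ip (F x) (F x) <= ip x x.
    by have := (norm_leP hdot _ ler01).1 Fb x; rewrite expr1n mul1r.
  have : 0 < k - m by rewrite subr_gt0.
  move: (ip (F x) (F x)) (ip x x) (ip (Y (F x)) (F x)) => u v w; nra.
have main : norm_le ((d + c * (k - m)) / (k + m)) (E * F).
  move=> x; set z := app (E * F) x.
  have zE : E z = z by rewrite /z -appM mulrA EE.
  have kmp : 0 < k + m by lra.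
  have l1 : (k + m) * N z <= N ((app (k *: (1 : V) + X)) z).
    have [z0|z0] := eqVneq (N z) 0; first by rewrite z0 mulr0 renorm_ge0.
    have zp : 0 < N z by rewrite lt0r z0 renorm_ge0.
    rewrite -(ler_pM2r zp); apply: le_trans (redot_CS hdot _ _).
    rewrite -mulrA -expr2 -(redotxx hdot) appD appZ app1 redotDl redotZl mulrDl lerD2l.
    by have := hE z; rewrite zE.
  have l2 : app (k *: (1 : V) + X) z =
     app (E * (X - Y) * F) x + app (E * ((k *: (1 : V) + Y) * F)) x.
    rewrite /z -appM -appD; congr app.
    have -> : (k *: (1 : V) + X) * (E * F) = E * (k *: (1 : V) + X) * F.
      by rewrite mulrA; congr (_ * _); rewrite mulrDl mulrDr EX -vscaleAl -vscaleAr mul1r mulr1.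
    by rewrite -!mulrA -mulrDr -mulrDl [_ + (k *: _ + Y)]addrC -addrA [Y + _]addrC subrK.
  have FG : F * ((k *: (1 : V) + Y) * F) = (k *: (1 : V) + Y) * F.
    by rewrite mulrA FGC -mulrA FF.
  have l3 : N (app (E * (X - Y) * F) x) <= d * N x.
    have : norm_le (1 * d * 1) (E * (X - Y) * F) by apply: norm_leM => //; [rewrite mul1r|apply: norm_leM].
    by rewrite mul1r mulr1; apply.
  have l4 : N (app (E * ((k *: (1 : V) + Y) * F)) x) <= c * (k - m) * N x.
    rewrite -FG mulrA.
    have : norm_le (c * (k - m)) (E * F * ((k *: (1 : V) + Y) * F)) by apply: norm_leM.
    by apply.
  rewrite mulrAC ler_pdivlMr // [N _ * (k + m)]mulrC (le_trans l1) // l2 (le_trans (renormD _ _)) //.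
  by rewrite [leRHS]mulrDl lerD.
have kmp : 0 < k + m by lra.
have : c <= (d + c * (k - m)) / (k + m).
  apply: opnorm_le main; rewrite divr_ge0 ?addr_ge0 ?mulr_ge0 //; lra.
rewrite ler_pdivlMr // => l.
rewrite ler_pdivlMr ?mulr_gt0 //; nra.
Qed.

End Perturbation.

(** * Orthogonalization of two nearly orthogonal projections *)

Section Orthogonalization.
Variables (R : realType) (H : completeNormedModType R[i]).
Variable dot : {dot H for (conjC : R[i] -> R[i])}.
Variable A : set (H -> H).
Hypothesis hdot : hilbert dot.
Variable hA : von_neumann_algebra dot A.

Local Notation ip := (redot dot).
Local Notation N := (@renorm R H).
Local Notation V := (vN hA).
Local Notation st := (star hdot).
Local Notation symmetry := (vn_symmetry hdot).
Local Notation gen := (generated hdot).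

Lemma redot_eq0 x : ip x x = 0 -> x = 0.
Proof. by rewrite redotxx // => /eqP; rewrite sqrf_eq0 => /eqP/renorm_eq0. Qed.

Lemma proj_ip_le (e : V) x : selfadj e -> e * e = e -> ip (e x) (e x) <= ip x x.
Proof.
move=> se ee; have := (norm_leP hdot _ ler01).1 (proj_norm_le1 hdot se ee) x.
by rewrite expr1n mul1r.
Qed.

Lemma selfadj_mul0 (a b : V) : selfadj a -> selfadj b -> a * b = 0 -> b * a = 0.
Proof.
move=> /(selfadjP hdot) ha /(selfadjP hdot) hb /(congr1 (fun u : V => st u)); rewrite starM ha hb => ->.
apply/(selfadjP hdot); exact: selfadj0.
Qed.

(** Symmetric (Loewdin) orthogonalization.  The sandwich identities say that,
for [Z = T * T] the inverse of [S = E + F + Q], the operators [T * e * T] with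
[e] below [E], [F] or [Q] multiply as the [e] would if [E], [F] and [Q] were
orthogonal.  They hold because the ranges of [E] and [F] meet in [0]: applying
[S] to [y = Z (E x)] gives [E y + F y + Q y = E x], so that [Q y = 0] and
[F y = E (x - y)] lies in both ranges. *)
Lemma lowdin_orthogonalization (E F : V) (r : R) : 0 <= r -> r <= 1 / 45 ->
  selfadj E -> E * E = E -> selfadj F -> F * F = F -> norm_le r (E * F) ->
  exists Q T G : V, [/\
    [/\ selfadj Q, Q * Q = Q & [/\ E * Q = 0, F * Q = 0, Q * E = 0 & Q * F = 0]],
    [/\ gen (E + F) Q, gen (E + F) T & selfadj T],
    [/\ T * G = 1, G * T = 1 & (E + F + Q) * T = G],
    [/\ E * (T * T) * E = E, F * (T * T) * F = F, Q * (T * T) * Q = Q &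
    [/\ E * (T * T) * F = 0, F * (T * T) * E = 0, E * (T * T) * Q = 0 &
    [/\ Q * (T * T) * E = 0, F * (T * T) * Q = 0 & Q * (T * T) * F = 0]]] &
    [/\ norm_le (2 * r) (E + F + Q - 1), norm_le (3 * r) (T - 1) & norm_le (6 * r) (G - 1)]].
Proof.
move=> r0 r1 sE EE sF FF EFr.
pose w : V := E + F.
have sw : selfadj w by exact: selfadjD.
have nw : gen w w by exact: gen_refl.
have [Q [nQ QQ wQ kQ aQ]] := kernel_projection nw.
have sQ : selfadj Q by have [] := nQ.
have wQ0 x : ip (E (Q x)) (E (Q x)) + ip (F (Q x)) (F (Q x)) = 0.
  have := congr1 (fun a : V => ip (app a x) (Q x)) wQ.
  rewrite app0 redot0l appM appD redotDl -{1}EE -{1}FF !appM sE (sF (F (Q x))) => h; exact: h.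
have EQ : E * Q = 0.
  apply: vN_ext => x; rewrite appM app0; apply: redot_eq0.
  have := wQ0 x; have := redot_ge0 hdot (E (Q x)); have := redot_ge0 hdot (F (Q x)); lra.
have FQ : F * Q = 0.
  apply: vN_ext => x; rewrite appM app0; apply: redot_eq0.
  have := wQ0 x; have := redot_ge0 hdot (E (Q x)); have := redot_ge0 hdot (F (Q x)); lra.
have QE : Q * E = 0 by exact: selfadj_mul0.
have QF : Q * F = 0 by exact: selfadj_mul0.
have bE := proj_norm_le1 hdot sE EE; have bF := proj_norm_le1 hdot sF FF.
have FEr : norm_le r (F * E).
  have := norm_le_star hdot r0 EFr; rewrite starM.
  by have/(selfadjP hdot) -> := sE; have/(selfadjP hdot) -> := sF.
(* [E + F] is close to the identity on its range, quantitatively *)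
have claim1 u : N (w (w u) - w u) <= 2 * r * N (w u).
  set a := E u; set b := F u.
  have Ea : E a = a by rewrite /a -appM EE.
  have Fb : F b = b by rewrite /b -appM FF.
  have wu : w u = a + b by [].
  rewrite wu; have -> : w (a + b) - (a + b) = E b + F a.
    by rewrite appD !appDr Ea Fb [a + E b]addrC addrACA addrK.
  have h1 : N (E b) <= r * N b by have := EFr b; rewrite appM Fb.
  have h2 : N (F a) <= r * N a by have := FEr a; rewrite appM Ea.
  have h3 : - (N a * (r * N b)) <= ip a b.
    have -> : ip a b = ip a (E b) by rewrite -sE Ea.
    have := redot_abs hdot a (E b); rewrite ler_norml => /andP[+ _].
    apply: le_trans; rewrite lerN2; apply: ler_wpM2l => //; exact: renorm_ge0.
  apply: (le_trans (renormD _ _)).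
  suff h4 : N a + N b <= 2 * N (a + b) by nra.
  rewrite -(@ler_pXn2r _ 2) ?nnegrE ?mulr_ge0 ?addr_ge0 ?renorm_ge0 //.
  rewrite exprMn -[N (a + b) ^+ 2](redotxx hdot) redotDl !redotDr (redotC dot b a) !redotxx //.
  have := renorm_ge0 a; have := renorm_ge0 b; move: h3; move: (N a) (N b) (ip a b) => p q t.
  move=> h3 q0 p0.
  have pq : 0 <= p * q by rewrite mulr_ge0.
  have : r * (p * q) <= 1 / 45 * (p * q) by rewrite ler_wpM2r.
  nra.
have bw : norm_le 2 w by apply: norm_leW (norm_leD bE bF); lra.
have s1Q : selfadj (1 - Q) by apply: selfadjB.
have p1Q : (1 - Q) * (1 - Q) = 1 - Q by rewrite mulrBr mulr1 mulrBl mul1r QQ subrr subr0.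
(* by density the same bound holds on the whole range of [1 - Q] *)
have claim2 x : N (w (x - Q x) - (x - Q x)) <= 2 * r * N (x - Q x).
  set k := x - Q x; apply/ler_addgt0Pr => e e0.
  have e4 : 0 < e / 4 by rewrite divr_gt0.
  have [u hu] := aQ x _ e4; rewrite -/k in hu; clearbody k.
  have -> : w k - k = w (k - w u) + (w (w u) - w u) - (k - w u).
    by rewrite appBr subrKA opprB addrA subrK.
  apply: (le_trans (renormB _ _)); apply: (le_trans (lerD (renormD _ _) (lexx _))).
  have := bw (k - w u); have := claim1 u.
  have : N (w u) <= N k + N (k - w u) by rewrite -{1}[w u](subKr k) renormB.
  move: hu; have := renorm_ge0 (w u); have := renorm_ge0 (k - w u).
  move: (N (k - w u)) (N (w u)) (N k) => p q t.
  move=> p0 q0 l1 l2 l3 l4.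
  have : r * q <= r * (t + p) by rewrite ler_wpM2l.
  have : r * p <= 1 / 45 * p by rewrite ler_wpM2r.
  lra.
pose S : V := E + F + Q.
have S1 : norm_le (2 * r) (S - 1).
  move=> x; have -> : app (S - 1) x = w (x - Q x) - (x - Q x).
    rewrite appB app1 appBr; have -> : w (Q x) = 0 by rewrite -appM wQ.
    by rewrite subr0 opprB addrA appD.
  apply: (le_trans (claim2 x)); rewrite ler_wpM2l ?mulr_ge0 //.
  have := proj_norm_le1 hdot s1Q p1Q x; rewrite mul1r; exact.
have nS : gen w S by apply: genD.
have [|Z nZ SZ] := op_inverse nS.
  apply: norm_le_distC; apply: norm_leW S1; lra.
have sS : selfadj S by have [] := nS.
have sZ : selfadj Z by have [] := nZ.
have ZS : Z * S = 1 by rewrite (gen_comm nZ nS).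
have S1' : norm_le (2 * r) (1 - S) by exact: norm_le_distC.
have pZ : op_ge0 Z.
  split=> // x; have {2}-> : x = S (Z x) by rewrite -appM SZ.
  rewrite -sS; have := redot_norm_geN hdot (Z x) S1; rewrite appB app1 redotBl.
  have := redot_ge0 hdot (Z x); nra.
have [T [nT pT TT]] := op_sqrt nZ pZ.
pose G : V := S * T.
have ST : S * T = T * S by exact: gen_comm nS nT.
have TG : T * G = 1 by rewrite /G ST mulrA TT ZS.
have GT : G * T = 1 by rewrite /G -mulrA TT SZ.
(* stated for an unordered pair, to be used for [E, F] and for [F, E] *)
have key (E1 F1 : V) : E1 * E1 = E1 -> F1 * F1 = F1 -> norm_le r (E1 * F1) ->
    Q * E1 = 0 -> Q * F1 = 0 -> E1 + F1 + Q = S -> 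
    E1 * Z * E1 = E1 /\ F1 * Z * E1 = 0.
  move=> EE1 FF1 b1 QE1 QF1 S1E.
  have key x : E1 (Z (E1 x)) = E1 x /\ F1 (Z (E1 x)) = 0.
    set y := Z (E1 x).
    have Sy : E1 y + F1 y + Q y = E1 x by rewrite -!appD S1E /y -appM SZ.
    have Qy : Q y = 0.
      have := congr1 (fun v => Q v) Sy.
      by rewrite !appDr -!appM QE1 QF1 QQ !app0 !add0r.
    rewrite Qy addr0 in Sy.
    suff u0 : F1 y = 0 by rewrite -[RHS]Sy u0 addr0.
    have Eu : E1 (F1 y) = F1 y.
      have -> : F1 y = E1 x - E1 y by rewrite -Sy addrC addrA addNr add0r.
      by rewrite appBr -!appM EE1.
    have Fu : F1 (F1 y) = F1 y by rewrite -appM FF1.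
    have := b1 (F1 y); rewrite appM Fu Eu => h; apply: renorm_eq0.
    have := renorm_ge0 (F1 y) => h0; apply/eqP; rewrite eq_le h0 andbT.
    have : r * N (F1 y) <= 1 / 45 * N (F1 y) by rewrite ler_wpM2r.
    lra.
  by split; apply: vN_ext => x; rewrite !appM; have [] := key x.
have [EZE FZE] := key E F EE FF EFr QE QF erefl.
have [FZF EZF] : F * Z * F = F /\ E * Z * F = 0.
  by apply: key => //; rewrite /S [F + E]addrC.
have QZ : Q * Z = Q.
  rewrite -[RHS]mulr1 -SZ mulrA; congr (_ * _).
  by rewrite /S !mulrDr QE QF QQ !add0r.
have ZQ : Z * Q = Q by rewrite (gen_comm nZ nQ).
have bT : norm_le (3 * r) (T - 1).
  move=> x; set y := app (T - 1) x.
  have h1 : N y <= N (app (Z - 1) x).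
    have -> : app (Z - 1) x = T y + y.
      rewrite /y !appB !app1 appBr -appM TT; rewrite addrA; congr (_ - _).
      by rewrite subrK.
    clearbody y; rewrite -(@ler_pXn2r _ 2) ?nnegrE ?renorm_ge0 // -!(redotxx hdot) redotDl !redotDr (redotC dot y (T y)).
    have := pT.2 y; have := redot_ge0 hdot (T y); lra.
  apply: (le_trans h1); set v := app _ x.
  have Sv : S v = app (1 - S) x by rewrite /v -appM mulrBr SZ mulr1.
  have h2 := S1' x; rewrite -Sv in h2.
  have h3 := S1 v; rewrite appB app1 in h3.
  have h4 : N v <= N (S v) + N (S v - v) by rewrite -{1}[v](subKr (S v)) renormB.
  have := renorm_ge0 v; have := renorm_ge0 x; move: h2 h3 h4.
  move: (N v) (N x) (N (S v)) (N (S v - v)) => p q a b l1 l2 l3 q0 p0.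
  have : r * p <= 1 / 45 * p by rewrite ler_wpM2r.
  have : 0 <= r * q by rewrite mulr_ge0.
  lra.
have bG : norm_le (6 * r) (G - 1).
  have -> : G - 1 = (S - 1) * (T - 1) + (S - 1) + (T - 1).
    rewrite /G mulrBr mulr1 subrK mulrBl mul1r addrA subrK; done.
  apply: norm_leW (norm_leD (norm_leD (norm_leM _ S1 bT) S1) bT); last by rewrite mulr_ge0.
  nra.
exists Q, T, G; rewrite !TT; split=> //.
- by split=> //; exact: pT.1.
- split=> //; first by rewrite QZ QQ.
  split=> //; first by rewrite -mulrA ZQ.
  by split=> //; [rewrite QZ|rewrite -mulrA ZQ|rewrite QZ].
Qed.

End Orthogonalization.

(** * Partition of the spectrum above a level *)

Section SpectralFamily.
Variables (R : realType) (H : completeNormedModType R[i]).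
Variable dot : {dot H for (conjC : R[i] -> R[i])}.
Variable A : set (H -> H).
Hypothesis hdot : hilbert dot.
Variable hA : von_neumann_algebra dot A.

Local Notation ip := (redot dot).
Local Notation N := (@renorm R H).
Local Notation V := (vN hA).
Local Notation st := (star hdot).
Local Notation symmetry := (vn_symmetry hdot).
Local Notation gen := (generated hdot).

(** Differences of the spectral projections [P i] of [X] above the levels
[i.+1 * r].  The [P i] decrease because a vector in the range of [P j] and in
the kernel of [P i] with [i < j] would have its quadratic form both above the
level of [j] and below that of [i]; and they vanish beyond the norm of [X]. *)
Lemma spectral_partition (X : V) (r : R) : 0 < r -> selfadj X -> exists n (E : 'I_n -> V),
  [/\ forall i, gen X (E i),
      forall i j, E i * E j = if i == j then E i else 0,
      forall x, r * ip (app (\sum_i E i) x) (app (\sum_i E i) x) <=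
                ip (X (app (\sum_i E i) x)) (app (\sum_i E i) x),
      forall x, ip (X (x - app (\sum_i E i) x)) (x - app (\sum_i E i) x) <=
                r * ip (x - app (\sum_i E i) x) (x - app (\sum_i E i) x) &
      norm_le r (\sum_(i < n) (i.+1%:R * r) *: E i - X * \sum_i E i)].
Proof.
move=> r0 sX.
pose t (i : nat) : R := i.+1%:R * r.
have tS i : t i.+1 = t i + r by rewrite /t -[i.+2]addn1 natrD mulrDl mul1r.
have ht i : exists P : V, [/\ gen X P, P * P = P,
    forall x, t i * ip (P x) (P x) <= ip (X (P x)) (P x) &
    forall x, ip (X (x - P x)) (x - P x) <= t i * ip (x - P x) (x - P x)].
  have sXt : selfadj (X - t i *: (1 : V)) by apply: selfadjB => //; apply: selfadjZ.
  have [P [nP PP h1 h2]] := spectral_projection hdot sXt.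
  exists P; split=> //.
  - apply: gen_trans nP; apply: genB; first exact: gen_refl.
    by apply: genZ; exact: gen1.
  - by move=> x; have := h1 x; rewrite appB appZ app1 redotBl redotZl subr_ge0.
  - by move=> x; have := h2 x; rewrite appB appZ app1 redotBl redotZl subr_le0.
have [P hP] := choice ht.
have nP i : gen X (P i) by have [] := hP i.
have PP i : P i * P i = P i by have [] := hP i.
have P1 i u : P i u = u -> t i * ip u u <= ip (X u) u.
  by have [_ _ h _] := hP i; move=> Pu; have := h u; rewrite Pu.
have P2 i u : P i u = 0 -> ip (X u) u <= t i * ip u u.
  by have [_ _ _ h] := hP i; move=> Pu; have := h u; rewrite Pu subr0.
have PC i j : P i * P j = P j * P i by exact: (gen_comm (nP i) (nP j)).
have Plt i j : (i < j)%N -> P i * P j = P j.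
  move=> ij; have tij : t i < t j by rewrite /t ltr_pM2r // ltr_nat.
  apply: vN_ext => x; apply/eqP; rewrite -subr_eq0 appM -opprB oppr_eq0; apply/eqP.
  set u := _ - _.
  have e v : P j (P i v) = P i (P j v) by rewrite -!appM PC.
  have f k v : P k (P k v) = P k v by rewrite -appM PP.
  have uj : P j u = u by rewrite /u appBr e !f.
  have ui : P i u = 0 by rewrite /u appBr f subrr.
  apply: (redot_eq0 hdot); have := P1 _ _ uj; have := P2 _ _ ui.
  have := redot_ge0 hdot u; clearbody u; nra.
have Ple i j : (i <= j)%N -> P i * P j = P j.
  by rewrite leq_eqVlt => /orP[/eqP ->|/Plt].
have Pge i j : (i <= j)%N -> P j * P i = P j by move=> h; rewrite PC Ple.
have [k k0 hk] := norm_le_ex X.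
have [n hn] : exists n, k < t n.
  exists (Num.truncn (k / r)); rewrite /t -ltr_pdivrMr //.
  by rewrite truncnS_gt.
have Pn : P n = 0.
  apply: vN_ext => x; rewrite app0; apply: (redot_eq0 hdot).
  have : P n (P n x) = P n x by rewrite -appM PP.
  move: (P n x) => u /P1; have := redot_norm_le hdot u hk; have := redot_ge0 hdot u; nra.
pose E (i : 'I_n) : V := P i - P i.+1.
have nE i : gen X (E i) by exact: genB.
have sE i : selfadj (E i) by have [] := nE i.
have EE i : E i * E i = E i.
  by rewrite /E mulrBr !mulrBl !PP (Ple i i.+1) // (Pge i i.+1) // !subrr subr0.
have Elt (i j : 'I_n) : (i < j)%N -> E i * E j = 0.
  move=> ij; rewrite /E mulrBr !mulrBl.
  by rewrite (Ple i j (ltnW ij)) (Ple _ j ij) !Ple ?subrr // ltnW // leqW.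
have orth (i j : 'I_n) : E i * E j = if i == j then E i else 0.
  have [->|ij] := eqVneq i j; first exact: EE.
  have [l|l|/val_inj e] := ltngtP i j; first exact: Elt.
    by rewrite (gen_comm (nE i) (nE j)) Elt.
  by rewrite e eqxx in ij.
have sumE : \sum_i E i = P 0.
  transitivity (\sum_(0 <= i < n) (P i - P i.+1)); first by rewrite big_mkord.
  have := telescope_sumr P (leq0n n); rewrite Pn sub0r => /(congr1 -%R).
  by rewrite opprK -sumrN => <-; apply: eq_bigr => i _; rewrite opprB.
exists n, E; split=> //.
- rewrite sumE => x; have [_ _ h _] := hP 0%N; have := h x.
  by rewrite {1}/t mul1r.
- rewrite sumE => x; have [_ _ _ h] := hP 0%N; have := h x.
  by rewrite /t mul1r.
set D := _ - _.
have DE x : app D x = \sum_(i < n) (((t i)%:C)%C *: E i x - X (E i x)).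
  rewrite /D appB mulr_sumr !app_sum -sumrB; apply: eq_bigr => i _.
  by rewrite appM appZ.
have sD : selfadj D.
  rewrite /D mulr_sumr -sumrB; apply: selfadj_sum => i _; apply: selfadjB.
    exact: selfadjZ.
  apply: selfadjM => //; exact: gen_comm (gen_refl _ sX) (nE i).
have Dform x : ip (app D x) x = \sum_(i < n) (t i * ip (E i x) (E i x) - ip (X (E i x)) (E i x)).
  rewrite DE redot_suml; apply: eq_bigr => i _.
  have e u : ip (E i u) (E i x) = ip (E i u) x by rewrite -sE -appM EE.
  rewrite redotBl redotZl e; congr (_ - _).
  by rewrite -!appM (gen_comm (gen_refl _ sX) (nE i)) !appM e.
have Db (i : 'I_n) x : [/\ t i * ip (E i x) (E i x) - ip (X (E i x)) (E i x) <= 0 &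
   - (r * ip (E i x) (E i x)) <= t i * ip (E i x) (E i x) - ip (X (E i x)) (E i x)].
  have h1 : P i (E i x) = E i x by rewrite -appM /E mulrBr PP Ple.
  have h2 : P i.+1 (E i x) = 0 by rewrite -appM /E mulrBr PP Pge // subrr.
  have := P1 _ _ h1; have := P2 _ _ h2; rewrite tS; split; lra.
apply: (norm_le_form hdot) => // x; rewrite Dform.
  apply: le_trans (_ : 0 <= _); last by rewrite mulr_ge0 ?redot_ge0 // ltW.
  by apply: sumr_le0 => i _; have [] := Db i x.
apply: le_trans (_ : - (r * \sum_i ip (E i x) (E i x)) <= _).
  by rewrite lerN2 ler_wpM2l ?(ltW r0) //; exact: bessel.
rewrite mulr_sumr -sumrN; apply: ler_sum => i _.
by have [] := Db i x.
Qed.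

End SpectralFamily.

(** * The structured pinching *)

Section StructuredPinching.
Variables (R : realType) (H : completeNormedModType R[i]).
Variable dot : {dot H for (conjC : R[i] -> R[i])}.
Variable A : set (H -> H).
Hypothesis hdot : hilbert dot.
Variable hA : von_neumann_algebra dot A.

Local Notation ip := (redot dot).
Local Notation N := (@renorm R H).
Local Notation V := (vN hA).
Local Notation st := (star hdot).
Local Notation symmetry := (vn_symmetry hdot).
Local Notation gen := (generated hdot).

Lemma norm_le_near1 (t : R) (a : V) : norm_le t (a - 1) -> norm_le (1 + t) a.
Proof. by move=> h; have := norm_leD (@norm_le1 _ _ _ _ _) h; rewrite [X in norm_le _ X]addrC subrK. Qed.

Lemma conj_near (t z : R) (a b : V) : 0 <= t -> 0 <= z -> norm_le t (a - 1) -> norm_le z b ->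
  norm_le (t * z * (1 + t) + z * t) (a * b * a - b).
Proof.
move=> t0 z0 ha hb.
have -> : a * b * a - b = (a - 1) * b * a + b * (a - 1).
  by rewrite !mulrBl mul1r mulrBr mulr1 addrA subrK.
apply: norm_leD; last exact: norm_leM.
by apply: norm_leM; [rewrite mulr_ge0|exact: norm_leM|exact: norm_le_near1].
Qed.

(** [c] nearly maps the range of [Q] to itself: the components of [c * Q] along
[E] and [F] are small, as [E * c1 * Q = c1 * E * Q = 0] with [c1] near [c], and
[E], [F], [Q] nearly add up to [1].  This serves both [X] and [B]. *)
Lemma corner_norm_le (E F Q c c1 c2 : V) (e k : R) : 0 <= e -> 0 <= k ->
  selfadj E -> E * E = E -> selfadj F -> F * F = F -> selfadj Q -> Q * Q = Q ->
  E * Q = 0 -> F * Q = 0 -> norm_le k (E + F + Q - 1) ->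
  c1 * E = E * c1 -> c2 * F = F * c2 -> norm_le 1 c -> norm_le e (c1 - c) -> norm_le e (c2 - c) ->
  norm_le (e + e + k) (c * Q - Q * c * Q).
Proof.
move=> e0 k0 sE EE sF FF sQ QQ EQ FQ hS E1 F2 hc h1 h2.
have bE := proj_norm_le1 hdot sE EE; have bF := proj_norm_le1 hdot sF FF.
have bQ := proj_norm_le1 hdot sQ QQ.
have key (G d : V) : norm_le 1 G -> G * Q = 0 -> d * G = G * d -> norm_le e (d - c) ->
    norm_le e (G * c * Q).
  move=> bG GQ dG hd.
  have -> : G * c * Q = - (G * (d - c) * Q).
    by rewrite mulrBr mulrBl -dG -[d * G * Q]mulrA GQ mulr0 sub0r opprK.
  apply: norm_leN; have -> : e = 1 * e * 1 by rewrite mul1r mulr1.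
  by apply: norm_leM => //; [rewrite mul1r|exact: norm_leM].
have -> : c * Q - Q * c * Q = E * c * Q + F * c * Q - (E + F + Q - 1) * (c * Q).
  rewrite mulrBl mul1r opprB !mulrDl !mulrA addrCA (opprD (E * c * Q + F * c * Q)).
  by rewrite addNKr.
apply: norm_leB; first by apply: norm_leD; [exact: key E1 h1|exact: key F2 h2].
have -> : k = k * (1 * 1) by rewrite !mulr1.
by apply: norm_leM => //; exact: norm_leM.
Qed.

(** The family [p] consists of the [T E_i T], the [T F_i T] and [T Q T], with
[sig] the exchange of the first two kinds and [lam] the eigenvalues of [X''].
The element [B3] stands for [eta^-1 theta B'], the approximation of [B] that
commutes with [phi X']. *)
Lemma structured_pinching (phi : V -> V) (X X' : V) (r : R) : symmetry phi ->
  (forall a, phi (phi a) = a) -> 0 < r -> r <= 1 / 45 ->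
  selfadj X -> norm_le 1 X -> phi X = - X -> selfadj X' -> norm_le (r ^+ 2) (X' - X) ->
  exists (J : finType) (p : J -> V) (sig : J -> J) (lam : J -> R),
  [/\ [/\ forall j, selfadj (p j), forall i j, p i * p j = if i == j then p i else 0,
          \sum_j p j = 1, forall j, phi (p j) = p (sig j) & involutive sig],
      forall j, lam (sig j) = - lam j,
      forall s, symmetry s -> (forall a, phi (s a) = s (phi a)) -> s X' = X' ->
        forall j, s (p j) = p j,
      norm_le (45 * r) (\sum_j lam j *: p j - X) &
      forall B B' B3, norm_le 1 B -> B' * X' = X' * B' -> B3 * phi X' = phi X' * B3 ->
        norm_le (r ^+ 2) (B' - B) -> norm_le (r ^+ 2) (B3 - B) ->
        norm_le (45 * r) (\sum_j p j * B * p j - B)].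
Proof.
move=> hphi phi2 r0 r1 sX bX phiX sX' bX'.
have rr : r ^+ 2 <= r / 45 by rewrite expr2 ler_pM2l //; lra.
have rr0 : 0 <= r ^+ 2 by rewrite sqr_ge0.
have r0' := ltW r0.
have [n [E [nE Eo Elow Eup Xh]]] := spectral_partition hdot r0 sX'.
set e : V := \sum_i E i in Elow Eup Xh.
have sE i : selfadj (E i) by have [] := nE i.
pose F i : V := phi (E i).
have sF i : selfadj (F i) by exact: sym_selfadj.
have Fo i j : F i * F j = if i == j then F i else 0.
  rewrite /F -(sym_comm hphi); last exact: gen_comm (nE i) (nE j).
  by rewrite Eo; case: ifP => // _; exact: sym0.
pose f : V := \sum_i F i.
have fE : f = phi e by rewrite sym_sum.
have se : selfadj e by exact: psum_selfadj.
have ee : e * e = e by exact: psum_proj.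
have sf : selfadj f by exact: psum_selfadj.
have ff : f * f = f by exact: psum_proj.
have be := proj_norm_le1 hdot se ee; have bf := proj_norm_le1 hdot sf ff.
pose Y : V := - phi X'.
have sY : selfadj Y by apply: selfadjN; exact: sym_selfadj.
have EX i : E i * X' = X' * E i by apply: gen_comm (nE i) (gen_refl _ sX').
have eX : e * X' = X' * e by rewrite mulr_suml mulr_sumr; apply: eq_bigr.
have fX : f * phi X' = phi X' * f by rewrite fE (sym_commC hphi eX).
have fY : f * Y = Y * f by rewrite mulrN mulNr fX.
have bY : norm_le (r ^+ 2) (Y - X).
  have -> : Y - X = - phi (X' - X) by rewrite (symB hphi) phiX opprK opprD.
  by apply: norm_leN; apply: (sym_norm_le hphi).
have fup x : ip (Y (f x)) (f x) <= - (r * ip (f x) (f x)).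
  have p1 : op_ge0 (e * X' * e - r *: e).
    split=> [|x0]; first by apply: selfadjB; [exact: selfadj_conj|exact: selfadjZ].
    rewrite appB redotBl appZ redotZl !appM se subr_ge0 (le_trans _ (Elow x0)) //.
    by rewrite -{1}ee appM se.
  have := (sym_op_ge0 hphi p1).2 x.
  rewrite (symB hphi) (sym_conj hphi) (symZ hphi) -fE appB appZ redotBl redotZl !appM sf subr_ge0.
  by rewrite -{1}ff appM sf appN redotNl lerN2.
have fdn x : - (r * ip (x - f x) (x - f x)) <= ip (Y (x - f x)) (x - f x).
  have p1 : op_ge0 ((1 - e) * (r *: (1 : V) - X') * (1 - e)).
    split=> [|x0].
      by apply: selfadj_conj; apply: selfadjB => //; exact: selfadjZ.
    rewrite !appM (selfadjB (@selfadj1 _ _ _ _ _) se).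
    have : ip (X' (app (1 - e) x0)) (app (1 - e) x0) <=
      r * ip (app (1 - e) x0) (app (1 - e) x0) by exact: Eup.
    by move: (app (1 - e) x0) => u hu; rewrite appB appZ app1 redotBl redotZl subr_ge0.
  have := (sym_op_ge0 hphi p1).2 x.
  rewrite (sym_conj hphi) !(symB hphi) (symZ hphi) (sym1 hphi) -fE !appM.
  rewrite (selfadjB (@selfadj1 _ _ _ _ _) sf) -[x - f x]/(app (1 - f) x).
  move: (app (1 - f) x) => u; rewrite appB appZ app1 redotBl redotZl subr_ge0.
  by rewrite appN redotNl lerN2.
have ef : norm_le r (e * f).
  have h : norm_le (r ^+ 2 + r ^+ 2) (X' - Y).
    by apply: norm_le_trans bX' _; exact: norm_le_distC.
  have h0 : 0 <= r ^+ 2 + r ^+ 2 by rewrite addr_ge0.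
  have := separated_norm_le hdot r0 h0 se ee sf ff sX' sY eX fY Elow fup h.
  by congr (norm_le _ _); field; rewrite gt_eqF.
have [Q [T [G [[sQ QQ [eQ fQ Qe Qf]] [nQ nT sT] [TG GT STG] 
  [eZe fZf QZQ [eZf fZe eZQ [QZe fZQ QZf]]] [bS bT bG]]]]] :=
  lowdin_orthogonalization hdot r0' r1 se ee sf ff ef.
have bQ := proj_norm_le1 hdot sQ QQ.
pose J : finType := (('I_n + 'I_n) + unit)%type.
pose d (j : J) : V := match j with inl (inl i) => E i | inl (inr i) => F i | inr _ => Q end.
pose p j := T * d j * T.
pose sig (j : J) : J := match j with inl (inl i) => inl (inr i) | inl (inr i) => inl (inl i) | inr u => inr u end.
pose lam (j : J) : R := match j with inl (inl i) => i.+1%:R * r | inl (inr i) => - (i.+1%:R * r) | inr _ => 0 end.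
have sumJ (K : J -> V) : \sum_j K j = \sum_i K (inl (inl i)) + \sum_i K (inl (inr i)) + K (inr tt).
  rewrite big_sumType big_sumType /=; congr (_ + _).
  by rewrite (big_pred1 tt) // => -[].
have sd j : selfadj (d j) by case: j => [[]|].
have psa j : selfadj (p j) by exact: selfadj_conj.
have Ee i : E i * e = E i by exact: psum_l.
have eE i : e * E i = E i by exact: psum_r.
have Ff i : F i * f = F i by exact: psum_l.
have fF i : f * F i = F i by exact: psum_r.
have sandwich (a g b h w : V) : a * g = a -> h * b = b -> g * (T * T) * h = w ->
    a * (T * T) * b = a * w * b.
  by move=> {1}<- {1}<- <-; rewrite !mulrA.
have dZd i j : d i * (T * T) * d j = if i == j then d i else 0.
  case: i j => [[i|i]|[]] [[j|j]|[]] /=.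
  - by rewrite (sandwich _ _ _ _ _ (Ee i) (eE j) eZe) Ee Eo.
  - by rewrite (sandwich _ _ _ _ _ (Ee i) (fF j) eZf) mulr0 mul0r.
  - by rewrite (sandwich _ _ _ _ _ (Ee i) QQ eZQ) mulr0 mul0r.
  - by rewrite (sandwich _ _ _ _ _ (Ff i) (eE j) fZe) mulr0 mul0r.
  - by rewrite (sandwich _ _ _ _ _ (Ff i) (fF j) fZf) Ff Fo.
  - by rewrite (sandwich _ _ _ _ _ (Ff i) QQ fZQ) mulr0 mul0r.
  - by rewrite (sandwich _ _ _ _ _ QQ (eE j) QZe) mulr0 mul0r.
  - by rewrite (sandwich _ _ _ _ _ QQ (fF j) QZf) mulr0 mul0r.
  - by [].
have porth i j : p i * p j = if i == j then p i else 0.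
  have -> : p i * p j = T * (d i * (T * T) * d j) * T by rewrite /p !mulrA.
  by rewrite dZd; case: ifP; rewrite // mulr0 mul0r.
pose S : V := e + f + Q.
have sumd : \sum_j d j = S by rewrite sumJ.
have psum : \sum_j p j = 1.
  by rewrite -mulr_suml -mulr_sumr sumd -mulrA STG TG.
have phif : phi f = e by rewrite fE phi2.
have phi_ef : phi (e + f) = e + f by rewrite (symD hphi) phif -fE addrC.
have phiT : phi T = T by have [_ _ h] := nT; exact: h.
have phiQ : phi Q = Q by have [_ _ h] := nQ; exact: h.
have phid j : phi (d j) = d (sig j) by case: j => [[i|i]|[]] //=; rewrite /F phi2.
have phip j : phi (p j) = p (sig j) by rewrite /p (sym_conj hphi) phiT phid.
exists J, p, sig, lam; split.
- by split=> //; case=> [[i|i]|[]].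
- by case=> [[i|i]|[]] //=; rewrite ?opprK ?oppr0.
- move=> s hs sphi sX0 j.
  have sEi i : s (E i) = E i by have [_ _ h] := nE i; exact: h.
  have sFi i : s (F i) = F i by rewrite /F -sphi sEi.
  have sef : s (e + f) = e + f.
    by rewrite (symD hs) !(sym_sum hs); congr (_ + _); apply: eq_bigr.
  have sTT : s T = T by have [_ _ h] := nT; exact: h.
  have sQQ : s Q = Q by have [_ _ h] := nQ; exact: h.
  by rewrite /p (sym_conj hs) sTT; case: j => [[i|i]|[]] /=; rewrite ?sEi ?sFi ?sQQ.
(* the distance of [X''] to [X]: discretization, replacement of [X'] and [Y] by
   [X], and the discarded part [X * Q] *)
- pose Y0 : V := \sum_(i < n) (i.+1%:R * r) *: E i.
  pose Z0 : V := Y0 - phi Y0.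
  have -> : \sum_j lam j *: p j = T * Z0 * T.
    have -> : \sum_j lam j *: p j = T * (\sum_j lam j *: d j) * T.
      rewrite mulr_sumr mulr_suml; apply: eq_bigr => j _.
      by rewrite /p -vscaleAr -vscaleAl.
    congr (_ * _ * _); rewrite sumJ /= scale0r addr0; congr (_ + _).
    rewrite (sym_sum hphi) -sumrN; apply: eq_bigr => i _.
    by rewrite (symZ hphi) scaleNr.
  have h1 : norm_le (r + r) (Z0 - (X' * e + Y * f)).
    have -> : X' * e + Y * f = X' * e - phi (X' * e).
      by rewrite (sym_comm hphi (esym eX)) -fE mulNr.
    have -> : Z0 - (X' * e - phi (X' * e)) = (Y0 - X' * e) - phi (Y0 - X' * e).
      by rewrite (symB hphi) /Z0 !opprB addrACA [RHS]addrACA [- phi Y0 + _]addrC.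
    by apply: norm_leB => //; apply: (sym_norm_le hphi).
  have h2 : norm_le (r ^+ 2 * 1 + r ^+ 2 * 1) (X' * e + Y * f - (X * e + X * f)).
    by rewrite opprD addrACA -!mulrBl; apply: norm_leD; exact: norm_leM.
  (* [Q] is orthogonal to [E], so [X' <= r] there, and to [F], so [Y >= - r] *)
  have h3 : norm_le (r + r ^+ 2) (Q * X * Q).
    have ulow u : e u = 0 -> ip (X u) u <= (r + r ^+ 2) * ip u u.
      move=> eu; have := Eup u; rewrite eu subr0.
      have := redot_norm_geN hdot u bX'; rewrite appB redotBl; lra.
    have uup u : f u = 0 -> - ((r + r ^+ 2) * ip u u) <= ip (X u) u.
      move=> fu; have := fdn u; rewrite fu subr0.
      have := redot_norm_le hdot u bY; rewrite appB redotBl; lra.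
    have rr1 : 0 <= r + r ^+ 2 by exact: addr_ge0.
    apply: (norm_le_form hdot); first by rewrite addr_gt0 // exprn_gt0.
    - exact: selfadj_conj.
    - move=> x; rewrite !appM sQ; apply: (le_trans (ulow _ _)); first by rewrite -appM eQ.
      by rewrite ler_wpM2l // proj_ip_le.
    - move=> x; rewrite !appM sQ; apply: (le_trans _ (uup _ _)); last by rewrite -appM fQ.
      by rewrite lerN2 ler_wpM2l // proj_ip_le.
  have h4 : norm_le (r ^+ 2 + r ^+ 2 + 2 * r) (X * Q - Q * X * Q).
    apply: (corner_norm_le rr0 _ se ee sf ff sQ QQ eQ fQ bS (esym eX) (esym fY) bX bX' bY).
    by rewrite mulr_ge0.
  have h5 : norm_le (r ^+ 2 + r ^+ 2 + 2 * r + (r + r ^+ 2)) (X * Q).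
    by rewrite -[X * Q](subrK (Q * X * Q)); exact: norm_leD.
  have h6 : norm_le (1 * (2 * r) + (r ^+ 2 + r ^+ 2 + 2 * r + (r + r ^+ 2))) (X * e + X * f - X).
    have -> : X * e + X * f - X = X * (e + f + Q - 1) - X * Q.
      by rewrite mulrBr !mulrDr mulr1 [RHS]addrAC addrK.
    by apply: norm_leB => //; exact: norm_leM.
  have h7 : norm_le (8 * r) (Z0 - X).
    apply: norm_leW (norm_le_trans (norm_le_trans h1 h2) h6); lra.
  have h8 : norm_le (6 / 5) Z0.
    rewrite -(subrK X Z0); apply: norm_leW (norm_leD h7 bX); lra.
  have r3 : 0 <= 3 * r by rewrite mulr_ge0.
  have h9 := conj_near r3 (ltac:(lra) : 0 <= 6 / 5 :> R) bT h8.
  apply: norm_leW (norm_le_trans h9 h7); nra.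
- move=> B B' B3 bB B'X B3X hB' hB3.
  have B'E i : E i * B' = B' * E i by have [_ h _] := nE i; rewrite h.
  have B3F i : F i * B3 = B3 * F i.
    have h : phi B3 * X' = X' * phi B3.
      by have := sym_commC hphi B3X; rewrite phi2.
    have [_ /(_ _ h) h' _] := nE i.
    by have := sym_commC hphi (esym h'); rewrite phi2.
  have B'e : e * B' = B' * e by rewrite mulr_suml mulr_sumr; apply: eq_bigr.
  have B3f : f * B3 = B3 * f by rewrite mulr_suml mulr_sumr; apply: eq_bigr.
  pose Phi : V := \sum_i E i * B * E i + \sum_i F i * B * F i + Q * B * Q.
  have g1 : norm_le (r ^+ 2 + r ^+ 2 + (r ^+ 2 + r ^+ 2) + (r ^+ 2 + r ^+ 2 + 2 * r))
      (Phi - B * S).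
    rewrite /Phi /S !mulrDr opprD [X in norm_le _ X]addrACA.
    apply: norm_leD; first (rewrite opprD [X in norm_le _ X]addrACA; apply: norm_leD).
    - exact: (pinch_near hdot sE Eo rr0 B'E hB').
    - exact: (pinch_near hdot sF Fo rr0 B3F hB3).
    - apply: norm_le_distC.
      apply: (corner_norm_le rr0 _ se ee sf ff sQ QQ eQ fQ bS (esym B'e) (esym B3f) bB hB' hB3).
      by rewrite mulr_ge0.
  have bT1 := norm_le_near1 bT; have bG1 := norm_le_near1 bG.
  have t0 : 0 <= 1 + 3 * r by lra.
  have g2 : norm_le ((1 + 3 * r) * (r ^+ 2 + r ^+ 2 + (r ^+ 2 + r ^+ 2) + (r ^+ 2 + r ^+ 2 + 2 * r)) *
       (1 + 3 * r)) (T * (Phi - B * S) * T).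
    apply: norm_leM => //; last exact: norm_leM.
    by rewrite mulr_ge0 // !addr_ge0 // mulr_ge0.
  have g3 : norm_le (3 * r * 1 * (1 + 6 * r) + 1 * (6 * r)) (T * (B * S) * T - B).
    have -> : T * (B * S) * T - B = (T - 1) * B * G + B * (G - 1).
      by rewrite -!mulrA STG !mulrA !mulrBl mul1r mulrBr mulr1 addrA subrK.
    have r3 : 0 <= 3 * r by rewrite mulr_ge0.
    by apply: norm_leD; apply: norm_leM; rewrite ?mulr1 //; rewrite -[3 * r]mulr1; exact: norm_leM.
  (* pinching [G * B * G] instead of [B] absorbs the inner factors [T] *)
  have g4 : norm_le (13 * r) (B - G * B * G).
    apply: norm_le_distC; have r6 : 0 <= 6 * r by rewrite mulr_ge0.
    have := conj_near r6 ler01 bG bB; apply: norm_leW; nra.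
  have g5 : norm_le (13 * r) (\sum_j p j * (B - G * B * G) * p j).
    by apply: pinch_norm_le => //; rewrite mulr_ge0.
  have PD : \sum_j p j * (G * B * G) * p j = T * Phi * T.
    have -> : Phi = \sum_j d j * B * d j by rewrite sumJ.
    rewrite mulr_sumr mulr_suml; apply: eq_bigr => j _.
    have -> : p j * (G * B * G) * p j = T * d j * (T * G) * B * (G * T) * d j * T.
      by rewrite /p !mulrA.
    by rewrite TG GT !mulr1 !mulrA.
  have -> : \sum_j p j * B * p j - B =
     \sum_j p j * (B - G * B * G) * p j + T * (Phi - B * S) * T + (T * (B * S) * T - B).
    rewrite mulrBr mulrBl -PD [_ + (_ - T * (B * S) * T)]addrA addrA subrK.
    congr (_ - _); rewrite -big_split /=; apply: eq_bigr => j _.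
    by rewrite -mulrDl -mulrDr subrK.
  apply: norm_leW (norm_leD (norm_leD g5 g2) g3); nra.
Qed.

End StructuredPinching.

(** * Maps on the algebra and the three ranges of eps *)

Section Assembly.
Variables (R : realType) (H : completeNormedModType R[i]).
Variable dot : {dot H for (conjC : R[i] -> R[i])}.
Variable A : set (H -> H).
Hypothesis hdot : hilbert dot.
Variable hA : von_neumann_algebra dot A.

Local Notation ip := (redot dot).
Local Notation N := (@renorm R H).
Local Notation V := (vN hA).
Local Notation st := (star hdot).
Local Notation symmetry := (vn_symmetry hdot).

Lemma dot_selfadj (a : V) x y : selfadj a -> dot (a x) y = dot x (a y).
Proof. by move=> /(selfadjP hdot) h; rewrite (adj_ex hdot a).1 -starE h. Qed.

Definition pinching (J : finType) (p : J -> V) (b : H -> H) : H -> H :=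
  \sum_j (app (p j) \o b \o app (p j)).

Lemma pinchingE (J : finType) (p : J -> V) (b : H -> H) x :
  pinching p b x = \sum_j p j (b (p j x)).
Proof. by rewrite /pinching fct_sumE. Qed.

Lemma pinching_app (J : finType) (p : J -> V) (b : V) :
  pinching p b = app (\sum_j p j * b * p j).
Proof. by apply: funext => x; rewrite pinchingE app_sum. Qed.

Lemma pinching_linear (J : finType) (p : J -> V) : linear_map_on A (pinching p).
Proof.
split=> [a Aa|c a b Aa Ab].
  by rewrite (_ : a = app (mkvN hA Aa)) // pinching_app; exact: vN_in.
apply: funext => x; rewrite [RHS]/= pinchingE.
rewrite (_ : (c *: pinching p a + pinching p b) x = c *: pinching p a x + pinching p b x) //.
rewrite !pinchingE scaler_sumr -big_split; apply: eq_bigr => j _ /=.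
rewrite (_ : (c *: a + b) (p j x) = c *: a (p j x) + b (p j x)) //.
by rewrite appDr appZr.
Qed.

(** Each term is the compression of the matrix by [p k]. *)
Lemma pinching_cp (J : finType) (p : J -> V) : (forall j, selfadj (p j)) ->
  completely_positive dot A (pinching p).
Proof.
move=> sp n a Aa ha v.
have -> : \sum_i \sum_j dot (pinching p (a i j) (v j)) (v i) =
   \sum_k \sum_i \sum_j dot (a i j (p k (v j))) (p k (v i)).
  rewrite exchange_big /=; rewrite [RHS]exchange_big /=.
  rewrite exchange_big /=; apply: eq_bigr => i _.
  rewrite [RHS]exchange_big /=; apply: eq_bigr => j _.
  rewrite pinchingE linear_sumlz; apply: eq_bigr => k _.
  exact: dot_selfadj.
by apply: sumr_ge0 => k _; exact: (ha (fun j => p k (v j))).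
Qed.

Lemma pinching_comm (J : finType) (p : J -> V) f (hf : linear_symmetry dot A f) :
  weakly_continuous dot A f -> (forall j, on_algebra (hA := hA) hf (p j) = p j) ->
  commute_on A (pinching p) f.
Proof.
move=> wf fp a Aa; have hs := on_algebra_symmetry hdot hA hf wf.
rewrite (_ : a = app (mkvN hA Aa)) //; set b := mkvN hA Aa.
rewrite -(on_algebraE hf) !pinching_app -(on_algebraE hf); congr app.
rewrite (sym_sum hs); apply: eq_bigr => j _.
by rewrite (sym_conj hs) fp.
Qed.

Lemma opnorm1 : (exists x : H, x <> 0) -> opnorm (1 : V) = 1.
Proof.
case=> x x0; apply/eqP; rewrite eq_le; apply/andP; split.
  by apply: opnorm_le => //; exact: norm_le1.
have := @norm_le_opnorm _ _ _ _ hA 1 (opnorm (1 : V)) (lexx _) x.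
rewrite app1 -{1}[N x]mul1r ler_pM2r // lt0r renorm_ge0 andbT.
by apply: contra_notN x0 => /eqP/renorm_eq0.
Qed.

Lemma mapnorm_unital (Psi : (H -> H) -> (H -> H)) : (exists x : H, x <> 0) ->
  Psi idfun = idfun -> (forall a : V, opnorm a <= 1 -> opnorm (Psi a) <= 1) ->
  mapnorm A Psi = 1.
Proof.
move=> nz Psi1 h.
have ub : ubound [set opnorm (Psi a) | a in [set a | A a /\ opnorm a <= 1]] 1.
  by move=> _ [a [Aa a1] <-]; exact: (h (mkvN hA Aa)).
have m1 : [set opnorm (Psi a) | a in [set a | A a /\ opnorm a <= 1]] 1.
  have e1 := opnorm1 nz; exists idfun => /=; last by rewrite Psi1.
  by split; [exact: vna_id hA|rewrite -[leRHS]e1].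
apply/eqP; rewrite eq_le; apply/andP; split.
  by apply: sup_le_ub => //; exists 1.
by apply: sup_upper_bound => //; split; exists 1.
Qed.

Definition cscale (c : R[i]) (a : V) : V := mkvN hA (A_scale hA c (vN_in a)).
Lemma cscaleE c a x : cscale c a x = c *: a x. Proof. by []. Qed.

Lemma norm_le_cscale c k (a : V) : `|c| = 1 -> norm_le k a -> norm_le k (cscale c a).
Proof. by move=> c1 h x; rewrite cscaleE /renorm normrZ c1 mul1r; exact: h. Qed.

Lemma pinch_cscale (J : finType) (p : J -> V) c (b : V) :
  \sum_j p j * cscale c b * p j = cscale c (\sum_j p j * b * p j).
Proof.
apply: vN_ext => x; rewrite cscaleE !app_sum scaler_sumr; apply: eq_bigr => j _.
by rewrite !appM cscaleE appZr.
Qed.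

Lemma sym_pinch (J : finType) (p : J -> V) (s : V -> V) (sig : J -> J) (b : V) :
  symmetry s -> involutive sig -> (forall j, s (p j) = p (sig j)) ->
  s (\sum_j p j * b * p j) = \sum_j p j * s b * p j.
Proof.
move=> hs inv sp; rewrite (sym_sum hs) [RHS](reindex_inj (inv_inj inv)).
by apply: eq_bigr => j _; rewrite (sym_conj hs) sp.
Qed.

Lemma star_pinch (J : finType) (p : J -> V) (b : V) : (forall j, selfadj (p j)) ->
  st (\sum_j p j * b * p j) = \sum_j p j * st b * p j.
Proof.
move=> sp; apply: star_uniq => x y; rewrite !app_sum redot_suml redot_sumr.
by apply: eq_bigr => j _; rewrite !appM (sp j) redot_star sp.
Qed.

Local Notation opmap := ((H -> H) -> (H -> H)).

(** The conclusion of the theorem for given [X''] and [Psi]; the two definitions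
after it split the hypotheses into those that concern [S] and the others, since
[X''] has to be chosen before [S] is known. *)
Definition conclusion (S : set opmap) (phi : opmap) (X X' : H -> H) (eps : R)
    (Z : H -> H) (Psi : opmap) :=
    [/\ linear_map_on A Psi, completely_positive dot A Psi,
        mapnorm A Psi = 1 & forall psi, S psi -> commute_on A Psi psi] /\
    forall (B B' : H -> H) (eta : R[i]) (theta : (H -> H) -> (H -> H)),
      A B -> opnorm B <= 1 ->
      `|eta| = 1 ->
      theta = phi \/ theta = lower_star dot phi ->
      theta B = eta *: B ->
      A B' -> X' \o B' = B' \o X' ->
      eps = Num.max (opnorm (X' - X)) (opnorm (B' - B)) ->
      let X'' := Z in
      let B'' := Psi B in
      [/\ A X'', A B'' & X'' \o B'' = B'' \o X''] /\
      [/\ selfadjoint dot X'', S_symmetric S X'',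
          opnorm (X'' - X) <= 45 * Num.sqrt eps,
          opnorm (B'' - B) <= 45 * Num.sqrt eps &
          phi X'' = - X'' /\ theta B'' = eta *: B''].

Definition hypotheses (phi : opmap) (X X' : H -> H) :=
  [/\ linear_symmetry dot A phi, weakly_continuous dot A phi, order_two A phi,
   [/\ A X, selfadjoint dot X, opnorm X <= 1 & phi X = - X] &
   A X' /\ selfadjoint dot X'].

Definition S_hypotheses (S : set opmap) (phi : opmap) (X X' : H -> H) :=
  [/\ forall psi, S psi -> linear_symmetry dot A psi,
      forall psi, S psi -> weakly_continuous dot A psi,
      forall psi, S psi -> commute_on A phi psi,
      S_symmetric S X & S_symmetric S X'].

Lemma order_two_nz phi : order_two A phi -> exists x : H, x <> 0.
Proof.
move=> [_ [a Aa ne]]; apply: contrapT => h; apply: ne; apply: funext => x.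
have z (y : H) : y = 0 by apply: contrapT => y0; apply: h; exists y.
by rewrite (z (phi a x)) (z (a x)).
Qed.

Lemma id_good (S : set opmap) : (exists x : H, x <> 0) ->
  [/\ linear_map_on A id, completely_positive dot A id,
      mapnorm A id = 1 & forall psi, S psi -> commute_on A id psi].
Proof. by move=> nz; split=> //; apply: mapnorm_unital. Qed.

(** The hypotheses on [eps] then force [X' = X] and [B' = B]. *)
Lemma exact_case S phi X X' eps : eps <= 0 -> hypotheses phi X X' ->
  S_hypotheses S phi X X' -> conclusion S phi X X' eps X id.
Proof.
move=> e0 [_ _ o2 [AX sX X1 pX] [AX' sX']] [_ _ _ SX _].
split; first by apply: id_good; exact: order_two_nz o2.
move=> B B' eta theta AB B1 eta1 ht tB AB' XB eE /=.
have bX : opnorm (X' - X) <= 0 by apply: le_trans e0; rewrite eE le_max lexx.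
have bB : opnorm (B' - B) <= 0 by apply: le_trans e0; rewrite eE le_max lexx orbT.
have zero (a b : V) : opnorm (a - b : V) <= 0 -> app a = app b.
  move=> /(@norm_le_opnorm _ _ _ _ hA) h; apply: funext => x; apply/eqP.
  rewrite -subr_eq0 -appB; apply/eqP/renorm_eq0/eqP; rewrite eq_le renorm_ge0 andbT.
  by have := h x; rewrite mul0r.
have XE : X' = X by exact: (zero (mkvN hA AX') (mkvN hA AX)).
have BE : B' = B by exact: (zero (mkvN hA AB') (mkvN hA AB)).
have z0 (f : H -> H) : opnorm (f - f) <= 45 * Num.sqrt eps.
  rewrite subrr; apply: (@opnorm_le _ _ _ _ hA 0).
    by rewrite mulr_ge0 ?sqrtr_ge0.
  by move=> x; rewrite app0 renorm0 !mulr_ge0 ?sqrtr_ge0 ?renorm_ge0.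
by rewrite -XE -BE in XB *; split; split=> //; rewrite ?XE ?BE.
Qed.

(** Here [45 * sqrt eps] exceeds the norm of [X]. *)
Lemma large_case S phi X X' eps : 1 / 45 < Num.sqrt eps -> hypotheses phi X X' ->
  S_hypotheses S phi X X' -> conclusion S phi X X' eps 0 id.
Proof.
move=> e1 [lphi wphi o2 [AX sX X1 pX] [AX' sX']] [lS wS _ _ _].
split; first by apply: id_good; exact: order_two_nz o2.
move=> B B' eta theta AB B1 eta1 ht tB AB' XB eE /=.
have f0 f : linear_symmetry dot A f -> weakly_continuous dot A f -> f 0 = 0.
  move=> lf wf; have := congr1 (fun a : V => app a) (sym0 (on_algebra_symmetry hdot hA lf wf)).
  exact.
split; split=> //.
- exact: (A0 hA).
- by apply: funext => x; rewrite -[RHS]/(app (mkvN hA AB) 0) app0r.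
- by apply/(selfadjointE hdot (0 : V)); exact: selfadj0.
- by move=> psi Spsi; apply: f0; [exact: lS|exact: wS].
- rewrite sub0r; apply: (@opnorm_le _ _ _ _ hA (- mkvN hA AX)).
    by rewrite mulr_ge0 ?sqrtr_ge0.
  apply: norm_leN; apply: norm_leW (norm_le_opnorm (a := mkvN hA AX) X1); lra.
- rewrite subrr; apply: (@opnorm_le _ _ _ _ hA 0).
    by rewrite mulr_ge0 ?sqrtr_ge0.
  by move=> x; rewrite app0 renorm0 !mulr_ge0 ?sqrtr_ge0 ?renorm_ge0.
- by rewrite oppr0 f0.
Qed.

(** [structured_pinching] with [r = sqrt eps].  The map [th] is the restriction
of [theta] to the algebra; both for [phi] and for [lower_star phi] it satisfies
the bound and the commutation that are required of [B3]. *)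
Lemma small_case phi X X' eps : 0 < eps -> Num.sqrt eps <= 1 / 45 ->
  opnorm (X' - X) <= eps -> hypotheses phi X X' ->
  exists Z, forall S, S_hypotheses S phi X X' -> 
  exists Psi, conclusion S phi X X' eps Z Psi.
Proof.
move=> e0 e1 hX [lphi wphi o2 [AX sX X1 pX] [AX' sX']].
set r := Num.sqrt eps in e1 *.
have r0 : 0 < r by rewrite sqrtr_gt0.
have r2 : r ^+ 2 = eps by rewrite sqr_sqrtr // ltW.
pose x : V := mkvN hA AX; pose x' : V := mkvN hA AX'.
have hphi := on_algebra_symmetry hdot hA lphi wphi.
set ph := on_algebra lphi in hphi.
have ph2 a : ph (ph a) = a by apply: val_inj; exact: (o2.1 _ (vN_in a)).
have px : ph x = - x by apply: val_inj; exact: pX.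
have sx : selfadj x by apply/(selfadjointE hdot).
have sx' : selfadj x' by apply/(selfadjointE hdot).
have bx : norm_le 1 x by exact: norm_le_opnorm.
have bx' : norm_le (r ^+ 2) (x' - x) by rewrite r2; exact: norm_le_opnorm.
have [J [p [sig [lam [[sp po p1 php inv] lamN hS hZ hB]]]]] :=
  structured_pinching hphi ph2 r0 e1 sx bx px sx' bx'.
pose z : V := \sum_j lam j *: p j.
have zp j : z * p j = lam j *: p j.
  rewrite mulr_suml (bigD1 j) //= -vscaleAl po eqxx big1 ?addr0 // => k kj.
  by rewrite -vscaleAl po (negbTE kj) scaler0.
have pz j : p j * z = lam j *: p j.
  rewrite mulr_sumr (bigD1 j) //= -vscaleAr po eqxx big1 ?addr0 // => k kj.
  by rewrite -vscaleAr po eq_sym (negbTE kj) scaler0.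
have r45 : 0 <= 45 * r by rewrite mulr_ge0 // ltW.
exists (app z) => S [lS wS cS SX SX']; exists (pinching p); split.
  split.
  - exact: pinching_linear.
  - exact: pinching_cp.
  - apply: mapnorm_unital; first exact: order_two_nz o2.
      rewrite -[idfun]/(app (1 : V)) pinching_app; congr app.
      by rewrite -[RHS]p1; apply: eq_bigr => j _; rewrite mulr1 po eqxx.
    move=> a a1; rewrite pinching_app; apply: opnorm_le => //.
    by apply: pinch_norm_le => //; exact: norm_le_opnorm.
  - move=> psi Spsi; apply: (pinching_comm (hf := lS _ Spsi) (wS _ Spsi)).
    apply: hS; first exact: on_algebra_symmetry (wS _ Spsi).
      by move=> a; apply: val_inj; exact: (cS _ Spsi _ (vN_in a)).
    by apply: val_inj; exact: (SX' _ Spsi).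
move=> B B' eta theta AB B1 eta1 ht tB AB' XB eE X'' B''.
pose b : V := mkvN hA AB; pose b' : V := mkvN hA AB'.
have bB : norm_le (r ^+ 2) (b' - b).
  by rewrite r2; apply: norm_le_opnorm; rewrite eE le_max lexx orbT.
have bb : norm_le 1 b by exact: norm_le_opnorm.
have bx0 : b' * x' = x' * b' by apply: val_inj; rewrite /= -XB.
have eta0 : eta != 0 by rewrite -normr_eq0 eta1 oner_eq0.
have etaV : `|eta^-1| = 1 by rewrite normfV eta1 invr1.
pose w : V := \sum_j p j * b * p j.
have B''E : B'' = app w by exact: (pinching_app p b).
have [th [thE thb thC thP]] : exists th : V -> V, [/\ forall a : V, app (th a) = theta a,
   norm_le (r ^+ 2) (th b' - th b), th b' * ph x' = ph x' * th b' &
   th w = \sum_j p j * th b * p j].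
  case: ht => ->.
  - exists ph; split=> //.
    + by rewrite -(symB hphi); apply: (sym_norm_le hphi) => //; exact: sqr_ge0.
    + exact: (sym_commC hphi bx0).
    + exact: (sym_pinch _ hphi inv php).
  - exists (fun a => ph (st a)); split=> //.
    + rewrite -(symB hphi); apply: (sym_norm_le hphi); first exact: sqr_ge0.
      have -> : st b' - st b = st (b' - b).
        by apply/esym/star_uniq => u v; rewrite !appB redotBl redotBr !redot_star.
      by apply: norm_le_star => //; exact: sqr_ge0.
    + apply: (sym_commC hphi).
      by have := congr1 (fun a => st a) bx0; rewrite !starM; have/(selfadjP hdot) -> := sx'.
    + by rewrite star_pinch //; exact: (sym_pinch _ hphi inv php).
have thbE : th b = cscale eta b by apply: val_inj; rewrite -[LHS]/(app (th b)) thE.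
have hw : norm_le (45 * r) (w - b).
  apply: (hB b b' (cscale eta^-1 (th b'))) => //.
  - apply: vN_ext => u; rewrite !appM !cscaleE appZr -!appM thC; done.
  - have -> : cscale eta^-1 (th b') - b = cscale eta^-1 (th b' - th b).
      apply: vN_ext => u; rewrite cscaleE !appB cscaleE thbE cscaleE scalerBr.
      by rewrite scalerA mulVf // scale1r.
    exact: norm_le_cscale.
have zw : z * w = w * z.
  rewrite mulr_sumr mulr_suml; apply: eq_bigr => j _.
  by rewrite !mulrA zp -!mulrA pz -vscaleAr -!vscaleAl -!vscaleAr.
have zfix f (lf : linear_symmetry dot A f) : weakly_continuous dot A f ->
  (forall j, on_algebra lf (p j) = p j) -> f (app z) = app z.
  move=> wf fp; rewrite -(on_algebraE lf); congr app.
  have hs := on_algebra_symmetry hdot hA lf wf.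
  by rewrite (sym_sum hs); apply: eq_bigr => j _; rewrite (symZ hs) fp.
rewrite B''E /X''; split; split.
- exact: vN_in.
- exact: vN_in.
- exact: (congr1 (fun a : V => app a) zw).
- apply/(selfadjointE hdot z); apply: selfadj_sum => j _; exact: selfadjZ.
- move=> psi Spsi; apply: (zfix _ (lS _ Spsi) (wS _ Spsi)).
  apply: hS; first exact: on_algebra_symmetry (wS _ Spsi).
    by move=> a; apply: val_inj; exact: (cS _ Spsi _ (vN_in a)).
  by apply: val_inj; exact: (SX' _ Spsi).
- exact: (opnorm_le (a := z - x)).
- exact: (opnorm_le (a := w - b)).
- split.
    rewrite -(on_algebraE lphi) -/ph -[RHS]/(app (- z)); congr app.
    rewrite (sym_sum hphi) (reindex_inj (inv_inj inv)) -sumrN; apply: eq_bigr => j _.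
    by rewrite (symZ hphi) php inv lamN scaleNr.
  by rewrite -thE thP thbE pinch_cscale.
Qed.

End Assembly.

(** * The theorem *)

Section Existence.
Variables (R : realType) (H : completeNormedModType R[i]).
Variable dot : {dot H for (conjC : R[i] -> R[i])}.
Variable A : set (H -> H).
Hypothesis hdot : hilbert dot.
Variable hA : von_neumann_algebra dot A.

(** The quantifier over [S] comes after the choice of [Z], so that a choice
function of these [Z] depends on [X], [X'], [phi] and [eps] only.  If
[opnorm (X' - X)] exceeds [eps] there is nothing to approximate. *)
Lemma structured_approximation (X X' : H -> H) (phi : (H -> H) -> (H -> H)) (eps : R) :
  exists Z, forall S, hypotheses dot A phi X X' -> S_hypotheses dot A S phi X X' ->
  exists Psi, conclusion dot A S phi X X' eps Z Psi.
Proof.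
have [e0|e0] := leP eps 0.
  by exists X => S h hS; exists id; exact: (exact_case hA e0 h hS).
have [e1|e1] := ltP (1 / 45) (Num.sqrt eps).
  by exists 0 => S h hS; exists id; exact: (large_case hdot hA e1 h hS).
have [[h hX]|no] := pselect (hypotheses dot A phi X X' /\ opnorm (X' - X) <= eps).
  have [Z hZ] := small_case hdot hA e0 e1 hX h.
  by exists Z => S _; exact: hZ.
exists 0 => S h hS; exists id; split.
  by apply: (id_good hA); have [_ _ o2 _ _] := h; exact: order_two_nz o2.
move=> B B' eta theta AB B1 eta1 ht tB AB' XB eE; exfalso; apply: no; split=> //.
by rewrite eE le_max lexx.
Qed.

End Existence.

Unset Implicit Arguments.

Theorem theorem7p1 (R : realType) (H : completeNormedModType R[i])
    (dot : {dot H for (conjC : R[i] -> R[i])}) (hdot : hilbert dot)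
    (A : set (H -> H)) (hA : von_neumann_algebra dot A) :
  (* [F] yields X'', which therefore depends on X, X', phi and eps only *)
  exists F : (H -> H) -> (H -> H) -> ((H -> H) -> (H -> H)) -> R -> (H -> H),
  forall (S : set ((H -> H) -> (H -> H))) (phi : (H -> H) -> (H -> H)),
    (forall psi, S psi -> linear_symmetry dot A psi) ->
    (forall psi, S psi -> weakly_continuous dot A psi) ->
    linear_symmetry dot A phi -> weakly_continuous dot A phi ->
    order_two A phi ->
    (forall psi, S psi -> commute_on A phi psi) ->
  forall X X' : H -> H,
    A X -> selfadjoint dot X -> S_symmetric S X -> opnorm X <= 1 ->
    phi X = - X ->
    A X' -> selfadjoint dot X' -> S_symmetric S X' ->
  forall eps : R,
  exists Psi : (H -> H) -> (H -> H),
    [/\ linear_map_on A Psi, completely_positive dot A Psi,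
        mapnorm A Psi = 1 & forall psi, S psi -> commute_on A Psi psi] /\
    forall (B B' : H -> H) (eta : R[i]) (theta : (H -> H) -> (H -> H)),
      A B -> opnorm B <= 1 ->
      `|eta| = 1 ->
      theta = phi \/ theta = lower_star dot phi ->
      theta B = eta *: B ->
      A B' -> X' \o B' = B' \o X' ->
      eps = Num.max (opnorm (X' - X)) (opnorm (B' - B)) ->
      let X'' := F X X' phi eps in
      let B'' := Psi B in
      [/\ A X'', A B'' & X'' \o B'' = B'' \o X''] /\
      [/\ selfadjoint dot X'', S_symmetric S X'',
          opnorm (X'' - X) <= 45 * Num.sqrt eps,
          opnorm (B'' - B) <= 45 * Num.sqrt eps &
          phi X'' = - X'' /\ theta B'' = eta *: B''].
Proof.
have [F hF] := choice (fun q : (H -> H) * (H -> H) * ((H -> H) -> (H -> H)) * R =>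
  structured_approximation hdot hA q.1.1.1 q.1.1.2 q.1.2 q.2).
exists (fun X X' phi eps => F (X, X', phi, eps)).
move=> S phi lS wS lphi wphi o2 cS X X' AX sX SX X1 pX AX' sX' SX' eps.
by apply: (hF (X, X', phi, eps)).
Qed.
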